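(* Let $N\ge 1$, let $\Omega\subset\mathbb{R}^N$ be a bounded domain with smooth boundary, let $a,b>0$ be constants, and let $f\in L^2(\Omega)$ be positive a.e. in $\Omega$. Then there exists a constant $\mu_{**}>0$ such that the problem $$-\Big(a-b\int_\Omega|\nabla u|^2dx\Big)\Delta u=\mu f(x)\ \text{ in }\Omega,\qquad u=0\ \text{ on }\partial\Omega,$$ with parameter $\mu\in\mathbb{R}$, has only three solutions (exactly three) for any $0<|\mu|<\mu_{**}$, only two solutions (exactly two) for $\mu=\pm\mu_{**}$, and a unique solution for any $|\mu|>\mu_{**}$.
   Context: Solutions are weak solutions: $u\in H_0^1(\Omega)$ is a solution if $\big(a-b\int_\Omega|\nabla u|^2dx\big)\int_\Omega\nabla u\cdot\nabla v\,dx=\mu\int_\Omega f v\,dx$ for all $v\in H_0^1(\Omega)$. *)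

(* Defs.v *)
From HB Require Import structures.
From mathcomp Require Import all_boot all_order all_algebra.
From mathcomp Require Import all_classical all_reals all_analysis.

Set Implicit Arguments.
Unset Strict Implicit.
Unset Printing Implicit Defensive.

Import Order.TTheory GRing.Theory Num.Theory.
Import numFieldNormedType.Exports.

Local Open Scope classical_set_scope.
Local Open Scope ring_scope.

(* The product sigma-algebra on R^n (as for [n.-tuple] in the library); it
   coincides with the Borel sigma-algebra. *)
Section measurable_rV.
Context {R : realType} (n : nat).

Let coord (i : 'I_n) (x : 'rV[R]_n) : measurableTypeR R := x ord0 i.

Let rV_set0 : g_sigma_preimage coord set0.
Proof. exact: sigma_algebra0. Qed.

Let rV_setC A : g_sigma_preimage coord A -> g_sigma_preimage coord (~` A).
Proof. exact: sigma_algebraC. Qed.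

Let rV_bigcup (F : _^nat) : (forall i, g_sigma_preimage coord (F i)) ->
  g_sigma_preimage coord (\bigcup_i (F i)).
Proof. exact: sigma_algebra_bigcup. Qed.

HB.instance Definition _ := @isMeasurable.Build default_measure_display
  'rV[R]_n (g_sigma_preimage coord) rV_set0 rV_setC rV_bigcup.

End measurable_rV.

Section lebesgue_rV.
Context {R : realType}.

Lemma measurable_coord n (i : 'I_n) :
  measurable_fun [set: 'rV[R]_n] (fun x => x ord0 i : measurableTypeR R).
Proof.
move=> _ Y mY; rewrite setTI; apply: sub_sigma_algebra => /=.
rewrite -bigcup_seq/=; exists i => /=; first by rewrite mem_index_enum.
by exists Y => //; rewrite setTI.
Qed.

Lemma measurable_fun_rVP d (T : measurableType d) n (f : T -> 'rV[R]_n) :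
  measurable_fun [set: T] f <->
  forall i, measurable_fun [set: T] (fun x => f x ord0 i : measurableTypeR R).
Proof.
split=> [mf i|mf].
  by apply: (measurableT_comp (measurable_coord i)).
apply: (measurability (\big[setU/set0]_(i < n) preimage_set_system setT
  (fun x : 'rV[R]_n => x ord0 i : measurableTypeR R) measurable)) => //.
move=> _ [A + <-]; rewrite -bigcup_seq/= => -[i _ [B mB <-]].
by rewrite setTI; exact: mf.
Qed.

Definition cons_rV n (p : measurableTypeR R * 'rV[R]_n) : 'rV[R]_n.+1 :=
  row_mx (const_mx p.1 : 'rV_1) p.2.

Lemma cons_rV0 n p : @cons_rV n p ord0 ord0 = p.1.
Proof.
rewrite /cons_rV (_ : @ord0 n = @lshift 1 n ord0); last exact: val_inj.
by rewrite (@row_mxEl R 1 1 n) mxE.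
Qed.

Lemma cons_rVS n p j : @cons_rV n p ord0 (lift ord0 j) = p.2 ord0 j.
Proof.
rewrite /cons_rV (_ : lift (@ord0 n) j = @rshift 1 n j); last exact: val_inj.
by rewrite (@row_mxEr R 1 1 n).
Qed.

Lemma measurable_cons_rV n : measurable_fun [set: _] (@cons_rV n).
Proof.
apply/measurable_fun_rVP => i; case: (unliftP ord0 i) => [j|] ->.
- under eq_fun do rewrite cons_rVS.
  exact: (measurableT_comp (measurable_coord j) measurable_snd).
- by under eq_fun do rewrite cons_rV0; exact: measurable_fst.
Qed.

HB.instance Definition _ n :=
  isMeasurableFun.Build _ _ _ _ (@cons_rV n) (@measurable_cons_rV n).

Section lebesgue_rV_step.
Context n (m : {sigma_finite_measure set 'rV[R]_n -> \bar R}).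

Definition lebesgue_rV_step : set 'rV[R]_n.+1 -> \bar R :=
  pushforward (lebesgue_measure \x m)%E (@cons_rV n).

Let step0 : lebesgue_rV_step set0 = 0%E.
Proof. exact: measure0. Qed.

Let step_ge0 A : (0 <= lebesgue_rV_step A)%E.
Proof. exact: measure_ge0. Qed.

Let step_sigma_additive : semi_sigma_additive lebesgue_rV_step.
Proof. exact: measure_semi_sigma_additive. Qed.

HB.instance Definition _ := isMeasure.Build _ _ _ lebesgue_rV_step
  step0 step_ge0 step_sigma_additive.

Let step_sigma_finite : sigma_finite [set: 'rV[R]_n.+1] lebesgue_rV_step.
Proof.
have /sigma_finiteP[F [FT ndF Foo]] := sigma_finiteT (@lebesgue_measure R).
have /sigma_finiteP[G [GT ndG Goo]] := sigma_finiteT m.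
pose g (x : 'rV[R]_n.+1) : measurableTypeR R * 'rV[R]_n :=
  (x ord0 ord0, \row_j x ord0 (lift ord0 j)).
have gK : cancel (@cons_rV n) g.
  move=> [a y]; rewrite /g cons_rV0; congr pair.
  by apply/rowP => j; rewrite mxE cons_rVS.
have mg : measurable_fun setT g.
  apply/measurable_fun_pair; first exact: measurable_coord.
  apply/measurable_fun_rVP => i; under eq_fun do rewrite mxE.
  exact: measurable_coord.
exists (fun i => g @^-1` (F i `*` G i)).
  rewrite -preimage_bigcup; apply/esym/seteqP; split=> // x _ /=.
  have [i _ Fi] : (\bigcup_i F i) (g x).1 by rewrite -FT.
  have [j _ Gj] : (\bigcup_i G i) (g x).2 by rewrite -GT.
  exists (maxn i j) => //; split.
  - by move: Fi; exact/subsetPset/ndF/leq_maxl.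
  - by move: Gj; exact/subsetPset/ndG/leq_maxr.
move=> i; have [? ?] := Foo i; have [? ?] := Goo i; split.
  by rewrite -[X in measurable X]setTI; apply: mg => //; exact: measurableX.
rewrite /lebesgue_rV_step /pushforward -comp_preimage.
rewrite (_ : g \o _ = id) ?preimage_id; last exact/funext.
by rewrite product_measure1E// lte_mul_pinfty// ge0_fin_numE.
Qed.

HB.instance Definition _ := Measure_isSigmaFinite.Build _ _ _ lebesgue_rV_step
  step_sigma_finite.

End lebesgue_rV_step.

Fixpoint lebesgue_rV n : {sigma_finite_measure set 'rV[R]_n -> \bar R} :=
  if n is n'.+1 then lebesgue_rV_step (lebesgue_rV n') else \d_(0 : 'rV[R]_0).

Lemma lebesgue_rV_box n (A : 'I_n -> set (measurableTypeR R)) :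
  (forall i, measurable (A i)) ->
  lebesgue_rV n [set x | forall i, A i (x ord0 i)] =
  (\prod_(i < n) lebesgue_measure (A i))%E.
Proof.
elim: n A => [|n IHn] A mA.
  rewrite big_ord0/= diracE mem_set//= => -[].
  by move=> m m0; exfalso; rewrite ltn0 in m0.
rewrite big_ord_recl /= /lebesgue_rV_step /pushforward.
rewrite -IHn; last by move=> i; exact: mA.
have mB : measurable [set x : 'rV[R]_n | forall i, A (lift ord0 i) (x ord0 i)].
  rewrite [X in measurable X](_ : _ = \bigcap_(i in [set: 'I_n])
    ((fun x : 'rV[R]_n => x ord0 i : measurableTypeR R) @^-1` A (lift ord0 i))).
    apply: fin_bigcap_measurable => // i _.
    by rewrite -[X in measurable X]setTI; exact: measurable_coord.
  by apply/seteqP; split=> [x Ax i _|x Ax i]; [exact: Ax|exact: (Ax i)].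
rewrite -product_measure1E//.
congr (product_measure1 _ _ _); apply/seteqP; split=> -[a y] /=.
  move=> Aay; split=> /= [|i].
    by have := Aay ord0; rewrite cons_rV0.
  by have := Aay (lift ord0 i); rewrite cons_rVS.
move=> [/= Aa Ay] i; case: (unliftP ord0 i) => [j ->|->].
  by rewrite cons_rVS; exact: Ay.
by rewrite cons_rV0.
Qed.

End lebesgue_rV.

Section smooth.
Context {R : realType} {n : nat}.
Implicit Types (f : 'rV[R]_n -> R) (Omega : set 'rV[R]_n).

Definition partial (i : 'I_n) f : 'rV[R]_n -> R := 'D_(delta_mx ord0 i) f.

(* C^oo: all the iterated partial derivatives exist and are continuous. *)
Definition smooth f :=
  forall s : seq 'I_n, let g := foldr partial f s in
    continuous g /\ forall i x, derivable g x (delta_mx ord0 i).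

Definition bounded_domain Omega :=
  [/\ Omega !=set0, open Omega, connected Omega & bounded_set Omega].

End smooth.

(* Near each boundary point, after relabelling the axes and possibly reversing
   one of them, Omega is the strict epigraph of a smooth function of the other
   n - 1 coordinates. *)
Definition smooth_boundary {R : realType} {n : nat} (Omega : set 'rV[R]_n) :=
  forall x0, (closure Omega `\` Omega°) x0 ->
    exists (i : 'I_n) (s : bool) (gamma : 'rV[R]_n.-1 -> R),
      smooth gamma /\
      \forall x \near x0,
        Omega x <-> gamma (col' i x) < (-1) ^+ s * x ord0 i.

Section sobolev.
Context {R : realType} {n : nat} (Omega : set 'rV[R]_n).
Implicit Types (u v g phi f : 'rV[R]_n -> R).

Local Notation leb := (lebesgue_rV n).

(* C_c^oo(Omega), each function being extended by 0 outside Omega. *)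
Definition test_function phi :=
  [/\ smooth phi, compact (closure [set x | phi x != 0]) &
      closure [set x | phi x != 0] `<=` Omega].

(* Only the restriction of a function to Omega matters in L^2(Omega). *)
Definition L2 u := (u \_ Omega) \in Lfun leb 2%:E.

Definition weak_partial_of (i : 'I_n) u g := L2 g /\
  forall phi, test_function phi ->
    \int[leb]_(x in Omega) (u x * partial i phi x) =
    - \int[leb]_(x in Omega) (g x * phi x).

Definition H1 u := L2 u /\ forall i, exists g, weak_partial_of i u g.

(* The weak partial derivative, determined up to a null subset of Omega;
   meaningful when u is in H^1(Omega). *)
Definition weak_partial (i : 'I_n) u : 'rV[R]_n -> R :=
  xget (cst 0) [set g | weak_partial_of i u g].

Definition grad_dot u v (x : 'rV[R]_n) : R :=
  \sum_(i < n) weak_partial i u x * weak_partial i v x.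

Definition H1_norm u : R :=
  Num.sqrt (\int[leb]_(x in Omega) (u x ^+ 2)
            + \int[leb]_(x in Omega) grad_dot u u x).

(* H_0^1(Omega): the closure of C_c^oo(Omega) in H^1(Omega). *)
Definition H10 u := H1 u /\
  forall e : R, 0 < e ->
    exists2 phi, test_function phi & H1_norm (u \- phi) < e.

Definition weak_solution (a b : R) f (mu : R) u := H10 u /\
  forall v, H10 v ->
    (a - b * \int[leb]_(x in Omega) grad_dot u u x)
      * \int[leb]_(x in Omega) grad_dot u v x
    = mu * \int[leb]_(x in Omega) (f x * v x).

(* Elements of H_0^1(Omega) are functions modulo equality a.e. in Omega. *)
Definition has_exactly (k : nat) (P : set ('rV[R]_n -> R)) :=
  exists w : 'I_k -> 'rV[R]_n -> R,
    [/\ forall i, P (w i),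
        forall i j, ae_eq leb Omega (w i) (w j) -> i = j &
        forall u, P u -> exists i, ae_eq leb Omega u (w i)].

End sobolev.

(* Main.v *)
(* With w the weak solution of -Delta w = f and D the squared norm of its
   gradient, u solves the problem for mu <> 0 iff u = s w with
   s (a - b D s^2) = mu: testing the equation against a function on which f does
   not integrate to 0 shows that the nonlocal coefficient cannot vanish, hence u
   is a multiple of w. The three regimes count the real roots of this cubic. The
   function w is obtained by the direct method: by the parallelogram identity, a
   minimizing sequence of the Dirichlet energy over test functions has Cauchy
   gradients, so that the Poincare inequality and the completeness of L^2 give
   a limit. *)
From HB Require Import structures.
From mathcomp Require Import all_boot all_order all_algebra.
From mathcomp Require Import all_classical all_reals all_analysis.
From mathcomp Require Import measurable_realfun ring lra.
Require Import Defs.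

Set Implicit Arguments.
Unset Strict Implicit.
Unset Printing Implicit Defensive.

Import Order.TTheory GRing.Theory Num.Theory.
Import numFieldNormedType.Exports.

Local Open Scope classical_set_scope.
Local Open Scope ring_scope.

(** * Square-integrable functions *)

(** [weak_partial] picks an unspecified weak derivative, so the argument carries explicit pairs
    [H10_gradient u g]; uniqueness of weak derivatives, by the fundamental lemma of the calculus of
    variations, shows that the integrals of [grad_dot] do not depend on the choice. Lebesgue measure
    on R^n adds one coordinate at a time, so integration by parts comes from Fubini's theorem by
    induction on the dimension. Boundedness of [Omega] gives the Poincare constant [4 * M ^+ 2].
    Limits are taken without weak convergence: an identity is verified up to an error whose square
    is at most [e] times a fixed quantity, with [e] arbitrary. D is positive because otherwise f
    would be orthogonal to all test functions, hence zero a.e., which is impossible for a function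
    positive a.e. on a nonempty open set. The threshold is the local maximum of [s (a - b D s^2)],
    namely [2/3 a sqrt(a / (3 b D))]. The value mu = 0, on which the statement is silent, behaves
    differently: there every u whose squared gradient norm is a / b is a solution. *)

Lemma discriminant_le (R : realFieldType) (p q r : R) :
  (forall t, 0 <= p + 2 * t * q + t ^+ 2 * r) -> q ^+ 2 <= p * r.
Proof.
move=> h; have := h 0; rewrite mulr0 mul0r expr0n mul0r !addr0 => p0.
have [r0|r0|r0] := ltgtP r 0.
(* A negative [r] is excluded by adding the inequalities at [t] and [- t]: the sum is
   [2 * (p + t ^+ 2 * r)], negative since [t >= 1] and [t * - r > p]. *)
- have := h ((`|q| + p + 1) / - r + 1).
  set t := _ + 1.
  have t1 : 1 <= t.
    by rewrite lerDr; apply: divr_ge0; [rewrite !addr_ge0|rewrite oppr_ge0 ltW].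
  have e : (t - 1) * - r = `|q| + p + 1.
    by rewrite addrK divfK// oppr_eq0 lt_eqF.
  have := ler_norm q; have := h (- t); nra.
- have := h (- q / r).
  rewrite (_ : _ + _ = p - q ^+ 2 / r); last by field; rewrite gt_eqF.
  by rewrite subr_ge0 ler_pdivrMr.
- subst r; rewrite mulr0.
  have [->|q0] := eqVneq q 0; first by rewrite expr0n.
  have := h (- (p + 1) / (2 * q)).
  rewrite (_ : _ + _ = -1); first by lra.
  by field.
Qed.

Section L2_inner_product.
Context d (T : measurableType d) (R : realType).
Variable mu : {measure set T -> \bar R}.
Implicit Types f g h : T -> R.

Lemma Lfun2P f : f \in Lfun mu 2%:E <->
  measurable_fun setT f /\ mu.-integrable setT (EFin \o (fun x => f x ^+ 2)).
Proof.
split=> [l2f|[mf if2]].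
  split; last exact: Lfun2_integrable_sqr.
  by move: l2f; rewrite inE => /andP[]; rewrite inE.
rewrite inE; apply/andP; split; rewrite inE//= /finite_norm unlock /=.
apply: poweR_lty; move/integrableP : if2 => [_]; apply: le_lt_trans.
rewrite le_eqVlt; apply/orP; left; apply/eqP; apply: eq_integral => x _ /=.
by rewrite powR_mulrn// -normrX.
Qed.

Definition inner f g : R := \int[mu]_x (f x * g x).

Lemma inner_integrable f g : f \in Lfun mu 2%:E -> g \in Lfun mu 2%:E ->
  mu.-integrable setT (EFin \o (fun x => f x * g x)).
Proof. by move=> hf hg; apply/Lfun1_integrable; exact: Lfun2_mul_Lfun1. Qed.

Lemma innerC f g : inner f g = inner g f.
Proof. by apply: eq_Rintegral => x _; rewrite mulrC. Qed.

Lemma inner_ge0 f : 0 <= inner f f.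
Proof. by apply: Rintegral_ge0 => x _; rewrite -expr2 sqr_ge0. Qed.

Lemma Lfun2D f g : f \in Lfun mu 2%:E -> g \in Lfun mu 2%:E ->
  (fun x => f x + g x) \in Lfun mu 2%:E.
Proof.
have h1 : (1 <= 2%:E :> \bar R)%E by rewrite lee_fin ler1n.
by have [_ H] := Lfun_addr_closed mu h1; exact: H.
Qed.

Lemma Lfun2Z a f : f \in Lfun mu 2%:E -> (fun x => a * f x) \in Lfun mu 2%:E.
Proof.
move=> hf; rewrite (_ : (fun _ => _) = a \o* f).
  by apply: Lfun_scale => //; rewrite ler1n.
by apply/funext => x /=; rewrite mulrC.
Qed.

Lemma Lfun2B f g : f \in Lfun mu 2%:E -> g \in Lfun mu 2%:E ->
  (fun x => f x - g x) \in Lfun mu 2%:E.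
Proof.
move=> hf /(Lfun2Z (-1)) hg.
by have := Lfun2D hf hg; under eq_fun do rewrite mulN1r.
Qed.

Lemma innerDl f g h : f \in Lfun mu 2%:E -> g \in Lfun mu 2%:E ->
  h \in Lfun mu 2%:E -> inner (fun x => f x + g x) h = inner f h + inner g h.
Proof.
move=> hf hg hh; rewrite /inner -RintegralD//; [|exact: inner_integrable..].
by apply: eq_Rintegral => x _; rewrite mulrDl.
Qed.

Lemma innerZl a f h : f \in Lfun mu 2%:E -> h \in Lfun mu 2%:E ->
  inner (fun x => a * f x) h = a * inner f h.
Proof.
move=> hf hh; rewrite /inner -RintegralZl//; last exact: inner_integrable.
by apply: eq_Rintegral => x _; rewrite mulrA.
Qed.

Lemma inner_CS f g : f \in Lfun mu 2%:E -> g \in Lfun mu 2%:E ->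
  inner f g ^+ 2 <= inner f f * inner g g.
Proof.
move=> hf hg; apply: discriminant_le => t.
have htg := Lfun2Z t hg; have hs := Lfun2D hf htg.
have := inner_ge0 (fun x => f x + t * g x).
rewrite innerDl// [inner f _]innerC [inner (fun _ =>
  t * _) _]innerC !innerDl// !innerZl//.
rewrite (innerC f (fun x => t * g x)) (innerC g (fun x => t * g x)) !innerZl//.
rewrite (innerC g f); congr (0 <= _); ring.
Qed.

Lemma EFin_inner f : f \in Lfun mu 2%:E ->
  (inner f f)%:E = (\int[mu]_x (f x ^+ 2)%:E)%E.
Proof.
move=> hf; rewrite /inner /Rintegral fineK.
  by apply: eq_integral => x _; rewrite expr2.
by apply: integrable_fin_num => //; exact: inner_integrable.
Qed.

Lemma inner_eq0 f : f \in Lfun mu 2%:E -> inner f f = 0 ->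
  {ae mu, forall x, f x = 0}.
Proof.
move=> hf f0; have [mf _] := (Lfun2P f).1 hf.
have : (\int[mu]_x `|(f x ^+ 2)%:E| = 0)%E.
  rewrite -[0%E]/(0:R)%:E -f0 EFin_inner//; apply: eq_integral => x _ /=.
  by rewrite ger0_norm ?sqr_ge0.
have mf2 : measurable_fun setT (EFin \o (fun x => f x ^+ 2) : T -> \bar R).
  by apply/measurable_EFinP; exact: measurable_funX.
move/(ae_eq_integral_abs mu measurableT mf2); apply: filterS => x /(_ I) [].
by move/eqP; rewrite sqrf_eq0 => /eqP.
Qed.

Lemma cvg_telescope_geometric (x : R^nat) (M : R) :
  (forall k, 4 ^+ k * (x k.+1 - x k) ^+ 2 <= M) -> cvgn x.
Proof.
move=> hx; have M0 : 0 <= M.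
  by apply: le_trans (hx 0%N); rewrite mul1r sqr_ge0.
(* [M + 1] bounds the square root of [M] without taking it. *)
have dx k : `|telescope x k| <= geometric (M + 1) 2^-1 k.
  rewrite /= exprVn ler_pdivlMr ?exprn_gt0//.
  set y := `|_| * _.
  have y0 : 0 <= y by rewrite mulr_ge0// exprn_ge0.
  have : y ^+ 2 <= M.
    rewrite exprMn real_normK ?num_real// mulrC -exprM mulnC exprM.
    by rewrite (_ : 2 ^+ 2 = 4 :> R) ?hx//; ring.
  by nra.
rewrite (_ : x = fun n => x 0%N + series (telescope x) n); last first.
  by apply/funext => n; rewrite -eq_sum_telescope.
apply: is_cvgD; first exact: is_cvg_cst.
apply: normed_cvg; apply: series_le_cvg dx _ => //.
  by move=> n; rewrite /= mulr_ge0 ?addr_ge0// exprn_ge0.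
by apply: is_cvg_geometric_series; rewrite ger0_norm// invf_lt1 ?ltr1n.
Qed.

Let sqn f := inner f f.

(* The sum of the [4^k (v_(k+1) - v_k)^2] is integrable, hence finite a.e. *)
Lemma L2_fast_cvg (v : nat -> T -> R) : (forall k, v k \in Lfun mu 2%:E) ->
  (forall k, sqn (fun x => v k.+1 x - v k x) <= 8^-1 ^+ k) ->
  {ae mu, forall x, cvgn (fun k => v k x)}.
Proof.
move=> hv dv.
pose g k x : \bar R := (4 ^+ k * (v k.+1 x - v k x) ^+ 2)%:E.
have hd k : (fun x => v k.+1 x - v k x) \in Lfun mu 2%:E by exact: Lfun2B.
have mg k : measurable_fun setT (g k).
  apply/measurable_EFinP; apply: measurable_funM => //.
  by apply: measurable_funX; have [] := (Lfun2P _).1 (hd k).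
have g0 k x : (0 <= g k x)%E.
  by rewrite lee_fin mulr_ge0 ?sqr_ge0// exprn_ge0.
have ig k : (\int[mu]_x g k x <= (1 / 2 ^+ k)%:E)%E.
  rewrite /g; under eq_integral do rewrite EFinM.
  rewrite ge0_integralZl//; last 2 first.
  - by apply/measurable_EFinP/measurable_funX; have [] := (Lfun2P _).1 (hd k).
  - by move=> x _; rewrite lee_fin sqr_ge0.
  rewrite -(EFin_inner (hd k)) -EFinM lee_fin.
  apply: (le_trans (ler_wpM2l _ (dv k))); first by rewrite exprn_ge0.
  rewrite -exprMn (_ : 4 * 8^-1 = 2^-1 :> R) ?exprVn ?mul1r//.
  by field.
have iG : (\int[mu]_x (\sum_(k <oo) g k x) < +oo)%E.
  rewrite integral_nneseries//.
  apply: (@le_lt_trans _ _ (2 : R)%:E); last by rewrite ltry.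
  apply: lime_le; first by apply: is_cvg_ereal_nneg_natsum => k _;
    exact: integral_ge0.
  apply: nearW => n.
  apply: (@le_trans _ _ (\sum_(0 <= k < n) (1 / 2 ^+ k)%:E)%E).
    by apply: lee_sum => k _.
  rewrite sumEFin lee_fin.
  have := @geometric_le_lim R n 1 2^-1 ler01.
  rewrite invr_gt0 ltr0n => /(_ isT); rewrite ger0_norm// invf_lt1// ltr1n.
  move=> /(_ isT); rewrite (_ : 1 * (1 - 2^-1)^-1 = 2); last by field.
  apply: le_trans; rewrite le_eqVlt; apply/orP; left; apply/eqP.
  by apply: eq_bigr => k _; rewrite /= exprVn.
have mG : measurable_fun setT ((fun x => \sum_(k <oo) g k x)%E : T -> \bar R).
  by apply: ge0_emeasurable_sum.
have G0 x : (0 <= \sum_(k <oo) g k x)%E by apply: nneseries_ge0.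
have : mu.-integrable setT (fun x => \sum_(k <oo) g k x)%E.
  apply/integrableP; split => //; apply: le_lt_trans iG.
  by rewrite le_eqVlt; apply/orP; left; apply/eqP/eq_integral => x _;
    rewrite gee0_abs.
move=> /(integrable_ae measurableT); apply: filterS => x /(_ I) Gx.
apply: (@cvg_telescope_geometric _ (fine (\sum_(k <oo) g k x)%E)) => k.
rewrite -lee_fin fineK// -/(g k x).
apply: le_trans (nneseries_lim_ge k.+1 _) => //.
by rewrite big_nat_recr//= leeDr// sume_ge0.
Qed.

(** Riesz-Fischer: a subsequence with fast decreasing increments converges a.e., and Fatou's lemma
    makes its pointwise limit the L^2 limit of the whole sequence. *)
Lemma L2_complete (u : nat -> T -> R) : (forall k, u k \in Lfun mu 2%:E) ->
  (forall e : R, 0 < e -> exists N, forall i j, (N <= i)%N -> (N <= j)%N ->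
    sqn (fun x => u i x - u j x) <= e) ->
  exists2 w, w \in Lfun mu 2%:E &
    forall e : R, 0 < e -> exists N, forall i, (N <= i)%N ->
      sqn (fun x => w x - u i x) <= e.
Proof.
move=> hu uC.
(* Against the weight [4^k] of the a.e. convergence lemma, the rate [8^-k] leaves the summable
   [2^-k]. *)
have /choice[N hN] k : exists N, forall i j, (N <= i)%N -> (N <= j)%N ->
    sqn (fun x => u i x - u j x) <= 8^-1 ^+ k.
  by apply: uC; rewrite exprn_gt0// invr_gt0.
(* Partial sums of the thresholds are nondecreasing and dominate each of them. *)
pose n k := (\sum_(i < k.+1) N i)%N.
have nN k : (N k <= n k)%N by rewrite /n big_ord_recr leq_addl.
have nS k : (n k <= n k.+1)%N by rewrite /n [X in (_ <= X)%N]big_ord_recr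
  leq_addr.
have ndn : {homo n : i j / (i <= j)%N} by exact: homo_leq leq_trans nS.
pose v k := u (n k).
have cv : {ae mu, forall x, cvgn (fun k => v k x)}.
  apply: L2_fast_cvg => [k|k]; first exact: hu.
  by apply: hN => //; exact: leq_trans (nS k).
(* The upper limit is measurable whether or not the sequence converges; [fine] makes it
   real-valued. *)
pose w x := fine (limn_esup (fun k => (v k x)%:E)).
have mw : measurable_fun setT w.
  apply: measurableT_comp => //; apply: measurable_fun_limn_esup => k.
  by apply/measurable_EFinP; have [] := (Lfun2P _).1 (hu (n k)).
have wE : {ae mu, forall x, v k x @[k --> \oo] --> w x}.
  apply: filterS cv => x cx.
  have : (EFin \o (fun k => v k x)) @ \oo --> (limn (fun k => v k x))%:E.
    by apply: cvg_EFin; [exact: nearW|exact: cx].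
  by move=> /cvg_limn_einf_sup[_]; rewrite /w => -> /=; exact: cx.
have key k i : (N k <= i)%N ->
    (\int[mu]_x ((w x - u i x) ^+ 2)%:E <= (8^-1 ^+ k)%:E)%E.
  move=> ki; have hd j := Lfun2B (hu (n j)) (hu i).
  pose h j x : \bar R := ((v j x - u i x) ^+ 2)%:E.
  have mh j : measurable_fun setT (h j).
    by apply/measurable_EFinP/measurable_funX; have [] := (Lfun2P _).1 (hd j).
  have h0 j x : setT x -> (0 <= h j x)%E by rewrite lee_fin sqr_ge0.
  have mwu : measurable_fun setT ((fun x => ((w x - u i x) ^+ 2)%:E) : T ->
    \bar R).
    apply/measurable_EFinP/measurable_funX/measurable_funB => //.
    by have [] := (Lfun2P _).1 (hu i).
  have mlim : measurable_fun setT ((fun x => limn_einf (h ^~ x)) : T -> \bar R).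
    apply: measurableT_comp => //; apply: measurable_fun_limn_esup => j.
    exact: measurableT_comp.
  rewrite (@ae_eq_integral _ _ _ mu setT (fun x => limn_einf (h ^~ x)))//;
    last first.
  - apply: filterS wE => x wx _.
    have : (h ^~ x) @ \oo --> ((w x - u i x) ^+ 2)%:E.
      apply: cvg_EFin; first exact: nearW.
      rewrite [X in _ --> X]expr2 (_ : _ \o _ = (fun j =>
        (v j x - u i x) * (v j x - u i x))).
        by apply: cvgM; apply: cvgB => //; exact: cvg_cst.
      by apply/funext => j; rewrite /= expr2.
    by move=> /cvg_limn_einf_sup[-> _].
  apply: (le_trans (fatou mu measurableT mh h0)).
  rewrite limn_einf_lim; apply: lime_le; first exact: is_cvg_einfs.
  apply: nearW => m; apply: ge_ereal_inf.
  (* The index [maxn m k] is in the tail from [m] on and past the threshold for [8^-k]. *)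
  exists (\int[mu]_x h (maxn m k) x)%E; first by exists (maxn m k) => //=;
    exact: leq_maxl.
  rewrite /h -EFin_inner; last exact: hd.
  rewrite lee_fin; apply: hN => //; apply: (leq_trans (nN k)).
  by apply: ndn; exact: leq_maxr.
have hw : w \in Lfun mu 2%:E.
  have hwu : (fun x => w x - u (N 0%N) x) \in Lfun mu 2%:E.
    apply/Lfun2P; split.
      apply: measurable_funB => //.
      by have [] := (Lfun2P _).1 (hu (N 0%N)).
    apply/integrableP; split.
      apply/measurable_EFinP/measurable_funX/measurable_funB => //.
      by have [] := (Lfun2P _).1 (hu (N 0%N)).
    apply: (@le_lt_trans _ _ (8^-1 ^+ 0 : R)%:E); last by rewrite ltry.
    apply: le_trans (key 0%N _ (leqnn _)); rewrite le_eqVlt; apply/orP; left.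
    by apply/eqP/eq_integral => x _ /=; rewrite ger0_norm// sqr_ge0.
  have := Lfun2D hwu (hu (N 0%N)).
  by under eq_fun do rewrite subrK.
exists w => // e e0.
have [k ke] : exists k, 8^-1 ^+ k <= e.
  have : `|8^-1 : R| < 1 by rewrite ger0_norm// invf_lt1// ltr1n.
  move=> /(cvg_geometric 1) /cvgrPdist_le /(_ e e0) [k _ /(_ k (leqnn k))].
  rewrite /= sub0r normrN mul1r ger0_norm ?exprn_ge0// => ke.
  by exists k.
exists (N k) => i ki; apply: le_trans ke; rewrite -lee_fin EFin_inner;
  last exact: Lfun2B.
exact: key.
Qed.

End L2_inner_product.

(** * Measure and integration on R^n *)

Section measurable_rV_topology.
Context (R : realType) (n : nat).
Implicit Types (A : set 'rV[R]_n) (x c : 'rV[R]_n).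

Lemma ball_rVP c (r : R) x : 0 < r ->
  ball c r x <-> forall i, `|c ord0 i - x ord0 i| < r.
Proof.
move=> r0; split=> [[_ h] i|h]; first exact: h.
by split=> // i j; rewrite (ord1 i); exact: h.
Qed.

(** Rational centres and radii [1/(m+1)] are enumerated by [pickle]; a code whose closed box leaves
    [A] gets radius 0, hence an empty ball. The closed boxes inside [A] later provide compact
    supports. *)
Lemma open_bigcup_ball A : open A ->
  exists (c : nat -> 'rV[R]_n) (r : nat -> R), A = \bigcup_k ball (c k) (r k) /\
    forall k, 0 < r k ->
      [set x : 'rV[R]_n | forall i, `|c k ord0 i - x ord0 i| <= r k] `<=` A.
Proof.
move=> oA.
pose cl (p : 'rV[rat]_n * nat) :=
  [set x : 'rV[R]_n | forall i, `|ratr (p.1 ord0 i) - x ord0 i| <=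
    p.2.+1%:R^-1].
pose c k : 'rV[R]_n :=
  if unpickle k is Some p then map_mx ratr (p : 'rV[rat]_n * nat).1 else 0.
pose r k : R := if unpickle k is Some p then
   if `[< cl p `<=` A >] then p.2.+1%:R^-1 else 0 else 0.
exists c, r.
have sub k : 0 < r k -> [set x : 'rV[R]_n | forall i,
  `|c k ord0 i - x ord0 i| <= r k] `<=` A.
  rewrite /r /c; case: unpickle => [p|]; last by rewrite ltxx.
  case: asboolP => [pA _|_]; last by rewrite ltxx.
  by move=> x /= hx; apply: pA => i; have := hx i; rewrite mxE.
split=> //; apply/seteqP; split=> [x Ax|x [k _ bx]]; last first.
  have r0 : 0 < r k by case: bx.
  by apply: (sub k r0) => i; apply/ltW; exact: (ball_rVP _ _ r0).1.
have /nbhs_ballP[e /= e0 eA] : nbhs x A by exact: open_nbhs_nbhs.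
(* Both [x] and the points of the box are within [1/(m+1)] of the rational centre, so
   [1/(m+1) < e/2] keeps the box inside [ball x e]. *)
pose m := (Num.trunc (2 / e)).+1.
have me : m.+1%:R^-1 < e / 2 :> R.
  rewrite -[e / 2]invrK ltf_pV2 ?posrE ?invr_gt0 ?divr_gt0// invf_div.
  apply: lt_trans (_ : m%:R < _); last by rewrite ltr_nat.
  by rewrite /m truncnS_gt.
have /choice[q hq] i : exists q : rat, `|ratr q - x ord0 i| < m.+1%:R^-1.
  have m0 : 0 < m.+1%:R^-1 :> R by rewrite invr_gt0 ltr0n.
  have [q] : exists q, ratr q \in
      `](x ord0 i - m.+1%:R^-1), (x ord0 i + m.+1%:R^-1)[%R.
    by apply: rat_in_itvoo; rewrite ltrBlDr -addrA ltrDl addr_gt0.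
  rewrite in_itv/= => /andP[q1 q2]; exists q; rewrite ltr_distl.
  by rewrite q1 q2.
pose p : 'rV[rat]_n * nat := (\row_i q i, m).
have pA : cl p `<=` A.
  move=> y /= hy; apply: eA; apply/ball_rVP => // i.
  have := hy i; have := hq i; rewrite mxE distrC => h1 h2.
  rewrite -(subrK (ratr (q i)) (x ord0 i)) -addrA (le_lt_trans (ler_normD _
    _))//.
  by rewrite [e]splitr ltrD// ?(lt_trans h1)// (le_lt_trans h2).
exists (pickle p) => //; rewrite /c /r pickleK asboolT//.
by apply/ball_rVP => // i; rewrite !mxE; exact: hq.
Qed.

Lemma measurable_ball_rV c (r : R) : measurable (ball c r).
Proof.
have [r0|r0] := ltP 0 r; last first.
  rewrite (_ : ball c r = set0)//.
  by apply/seteqP; split=> // x [] /lt_le_trans /(_ r0); rewrite ltxx.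
rewrite (_ : ball c r = \bigcap_(i in [set: 'I_n])
    ((fun x : 'rV[R]_n => x ord0 i : measurableTypeR R) @^-1` ball (c ord0 i)
      r)); last first.
  apply/seteqP; split=> x.
    by move/(ball_rVP _ _ r0) => h i _; exact: h.
  by move=> h; apply/(ball_rVP _ _ r0) => i; exact: h.
apply: fin_bigcap_measurable => // i _.
rewrite -[X in measurable X]setTI; apply: measurable_coord => //.
exact: measurable_ball.
Qed.

Lemma open_measurable_rV A : open A -> measurable A.
Proof.
move=> /open_bigcup_ball[c [r [-> _]]].
by apply: bigcupT_measurable => k; exact: measurable_ball_rV.
Qed.

(** Balls are measurable and coordinates are continuous. This lets the open sets serve as generating
    pi-system in Dynkin's theorem. *)
Lemma measurable_rV_open : @measurable _ 'rV[R]_n = <<s open >>.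
Proof.
apply/seteqP; split; last first.
  apply: smallest_sub; first exact: sigma_algebra_measurable.
  by move=> A; exact: open_measurable_rV.
apply: smallest_sub; first exact: smallest_sigma_algebra.
rewrite -bigcup_seq => _ [i _] [B mB <-].
suff : measurable_fun [set: g_sigma_algebraType (@open 'rV[R]_n)]
    (fun x : 'rV[R]_n => x ord0 i : measurableTypeR R) by exact.
apply: (measurability _ (RGenOpens.measurableE R)) => // _ [_ [a [b ->] <-]].
apply: sub_sigma_algebra; rewrite setTI.
by apply: open_comp; [move=> ? _; exact: coord_continuous|exact: interval_open].
Qed.

Lemma continuous_measurable_rV (f : 'rV[R]_n -> R) :
  continuous f -> measurable_fun setT f.
Proof.
move=> cf; apply: (measurability _ (RGenOpens.measurableE R)).
move=> _ [_ [a [b ->] <-]]; rewrite setTI; apply: open_measurable_rV.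
by apply: open_comp; [move=> ? _; exact: cf|exact: interval_open].
Qed.

End measurable_rV_topology.

Section line_derivative.
Context (K : numFieldType) (U V W : normedModType K).

(** As [phi] is affine along the line, both difference quotients are the same function of [h]. It
    serves for slices of functions of [n.+1] variables and for functions of one coordinate. *)
Lemma is_derive_line (phi : U -> V) (a v : U) (v' : V) (f : V -> W) df :
  (forall h, phi (h *: v + a) = h *: v' + phi a) ->
  is_derive (phi a) v' f df -> is_derive a v (f \o phi) df.
Proof.
move=> hphi [fa fv].
have E : (fun h : K => h^-1 *: (((f \o phi) \o shift a) (h *: v) - (f \o phi)
  a)) =
         (fun h : K => h^-1 *: ((f \o shift (phi a)) (h *: v') - f (phi a))).
  by apply/funext => h /=; rewrite hphi.
split; first by rewrite /derivable E.
by rewrite /derive E.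
Qed.

End line_derivative.

Section norm_rV.
Context (R : realType) (n : nat).
Implicit Types x : 'rV[R]_n.

Lemma norm_rVP x (M : R) : 0 <= M ->
  `|x| <= M <-> forall i, `|x ord0 i| <= M.
Proof.
move=> M0; have -> : `|x| = \big[Num.max/0]_ij `|x ij.1 ij.2|.
  by rewrite -mx_normrE.
split.
  by move=> /bigmax_leP[_ h] i; exact: (h (ord0, i) isT).
by move=> h; apply/bigmax_leP; split=> // -[i j] _ /=; rewrite (ord1 i);
  exact: h.
Qed.

Lemma coord_le_norm x i : `|x ord0 i| <= `|x|.
Proof. by apply: (norm_rVP _ (normr_ge0 x)).1. Qed.

Lemma measurable_norm_le (M : R) : measurable [set x : 'rV[R]_n | `|x| <= M].
Proof.
rewrite -[X in measurable X]setTI.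
rewrite (_ : [set x | _] = (@Num.norm R 'rV[R]_n) @^-1` `]-oo, M]%classic).
  have := @continuous_measurable_rV R n (@Num.norm R 'rV[R]_n)
    (@norm_continuous _ _).
  by apply => //; exact: measurable_itv.
by apply/seteqP; split=> x /=; rewrite in_itv.
Qed.

Lemma lebesgue_rV_bounded (M : R) :
  (lebesgue_rV n [set x : 'rV[R]_n | (`|x| <= M)%R] < +oo)%E.
Proof.
have [M0|M0] := ltP M 0.
  rewrite (_ : [set _ | _] = set0) ?measure0//.
  by apply/seteqP; split=> // x /= /(le_trans (normr_ge0 x)); rewrite leNgt M0.
have -> : [set x : 'rV[R]_n | (`|x| <= M)%R] =
    [set x | forall i, (fun=> `[(- M), M]%classic) i (x ord0 i)]; last first.
  rewrite (@lebesgue_rV_box R n (fun=> `[(- M), M]%classic))//.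
  rewrite (_ : (\prod_(i < n) _)%E = (\prod_(i < n) (M - - M))%:E) ?ltry//.
  rewrite -prodEFin; apply: eq_bigr => i _.
  rewrite lebesgue_measure_itv/= lte_fin; case: ltP => // h.
  by congr EFin; lra.
apply/seteqP; split=> x /=.
  by move/(norm_rVP _ M0) => h i; rewrite in_itv/= -ler_norml.
by move=> h; apply/(norm_rVP _ M0) => i; have := h i;
  rewrite in_itv/= -ler_norml.
Qed.

End norm_rV.

Section compact_support.
Context (R : realType) (n : nat).
Implicit Types (F : 'rV[R]_n -> R) (M : R).

Lemma compact_support_bounded F M : continuous F ->
  (forall x, F x != 0 -> `|x| <= M) -> exists C : R, forall x, `|F x| <= C.
Proof.
move=> cF sF.
have cK : compact (closed_ball_ Num.norm (0 : 'rV[R]_n) M).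
  apply: bounded_closed_compact.
    exists M; split; first exact: num_real.
    by move=> N MN x; rewrite /closed_ball_/= sub0r normrN => /le_trans;
      apply; exact: ltW.
  exact: closed_closed_ball_.
have /compact_bounded[C [_ hC]] : compact (F @` closed_ball_ Num.norm (0 :
  'rV[R]_n) M).
  by apply: continuous_compact => //; exact: continuous_subspaceT.
exists (`|C| + 1) => x; have [->|Fx] := eqVneq (F x) 0.
  by rewrite normr0 addr_ge0.
apply: hC; first by rewrite (le_lt_trans (ler_norm C))// ltrDl.
by exists x => //; rewrite /closed_ball_/= sub0r normrN; exact: sF.
Qed.

Lemma compact_support_integrable F M : continuous F ->
  (forall x, F x != 0 -> `|x| <= M) ->
  (lebesgue_rV n).-integrable setT (EFin \o F).
Proof.
move=> cF sF; have [C hC] := compact_support_bounded cF sF.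
have mF : measurable_fun setT F by exact: continuous_measurable_rV.
have -> : EFin \o F = ((EFin \o F) \_ [set x : 'rV[R]_n | `|x| <= M]).
  apply/funext => x; rewrite patchE; case: ifPn => //;
    rewrite notin_setE /= => h.
  by congr EFin; apply: contra_notP h => /eqP /sF.
rewrite -integrable_mkcond; last exact: measurable_norm_le.
apply: measurable_bounded_integrable => //; try exact: measurable_norm_le.
- exact: lebesgue_rV_bounded.
- exact: measurable_funTS.
- exists C; split; first exact: num_real.
  by move=> N CN x _; exact: le_trans (ltW CN).
Qed.

End compact_support.

(** * The integral of a compactly supported partial derivative vanishes *)

Section partial_integral.
Context (R : realType).

(** The fundamental theorem of calculus on [[- b, b]] with [b = |M| + 1], so that [F] vanishes at
    both ends. *)
Lemma integral_derive_line (F G : R -> R) (M : R) : continuous G ->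
  (forall t, F t != 0 -> `|t| <= M) -> (forall t, G t != 0 -> `|t| <= M) ->
  (forall t : R, is_derive t (1 : R) F (G t)) ->
  (\int[@lebesgue_measure R]_t (G t)%:E = 0)%E.
Proof.
move=> cG sF sG dF; pose b : R := `|M| + 1; pose a : R := - b.
have out (t : R) : `|M| + 1 <= `|t| -> ~~ (`|t| <= M).
  by move=> h; rewrite -ltNge (lt_le_trans _ h)// (le_lt_trans (ler_norm
    M))// ltrDl.
have b1 : 0 < b by rewrite ltr_wpDl.
have F0 t : `|M| + 1 <= `|t| -> F t = 0.
  by move=> /out; apply: contraNeq; exact: sF.
have ab : a < b by rewrite /a; lra.
have cF : continuous F.
  move=> t; apply/differentiable_continuous/derivable1_diffP.
  exact: (@ex_derive _ _ _ _ _ _ _ (dF t)).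
have := @continuous_FTC2 R G F a b ab.
rewrite (F0 a) ?(F0 b) ?subee//; last 2 first.
- exact: ler_norm.
- by rewrite /a normrN; exact: ler_norm.
have FG : {in `]a, b[, (F^`())%classic =1 G}.
  by move=> t _; rewrite derive1E; exact: (@derive_val _ _ _ _ _ _ _ (dF t)).
have dFoo : derivable_oo_LRcontinuous F a b.
  split; first by move=> t _; exact: (@ex_derive _ _ _ _ _ _ _ (dF t)).
    exact/cvg_at_right_filter/cF.
  exact/cvg_at_left_filter/cF.
move=> /(_ (continuous_subspaceT cG) dFoo FG) <-.
rewrite [RHS]integral_mkcond; apply: eq_integral => t _; rewrite patchE.
case: ifPn => // /negP tab; congr EFin; apply: contra_notP tab => /eqP/sG.
move=> Mt; rewrite inE/= in_itv/= -ler_norml (le_trans Mt)//.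
by rewrite (le_trans (ler_norm M))// lerDl.
Qed.

Lemma integral_lebesgue_rVS n (f : 'rV[R]_n.+1 -> \bar R) :
  (lebesgue_rV n.+1).-integrable setT f ->
  (lebesgue_measure \x lebesgue_rV n)%E.-integrable setT (f \o @cons_rV R n) /\
  (\int[lebesgue_rV n.+1]_x f x =
   \int[(lebesgue_measure \x lebesgue_rV n)%E]_z (f \o @cons_rV R n) z)%E.
Proof.
move=> intf; have mf := measurable_int _ intf.
have ge0E (g : 'rV[R]_n.+1 -> \bar R) : measurable_fun setT g ->
    (forall x, 0 <= g x)%E ->
    (\int[lebesgue_rV n.+1]_x g x =
     \int[(lebesgue_measure \x lebesgue_rV n)%E]_z (g \o @cons_rV R n) z)%E.
  move=> mg g0.
  have := @ge0_integral_pushforward _ _ _ _ R (@cons_rV R n)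
    (@measurable_cons_rV R n) (lebesgue_measure \x lebesgue_rV n)%E setT g
    measurableT mg (fun x _ => g0 x).
  rewrite preimage_setT => <-.
  exact: eq_measure_integral.
have ifc : (lebesgue_measure \x lebesgue_rV n)%E.-integrable setT (f \o
  @cons_rV R n).
  apply/integrableP; split; first exact: measurableT_comp
    (@measurable_cons_rV R n).
  move/integrableP : (intf) => [_]; rewrite ge0E//.
  exact: measurableT_comp.
split=> //.
have := @integral_pushforward _ _ _ _ R (@cons_rV R n)
    (@measurable_cons_rV R n) (lebesgue_measure \x lebesgue_rV n)%E setT f mf.
rewrite preimage_setT => /(_ ifc measurableT) <-.
exact: eq_measure_integral.
Qed.

(** Induction on the dimension with Fubini's theorem. For a derivative along the first coordinate,
    that coordinate is integrated first, by the one-variable case; otherwise the remaining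
    coordinates are, by the induction hypothesis on each slice. *)
Lemma integral_partial_eq0 n (i : 'I_n) (F G : 'rV[R]_n -> R) (M : R) :
  continuous G -> (forall x, F x != 0 -> `|x| <= M) ->
  (forall x, G x != 0 -> `|x| <= M) ->
  (forall x, is_derive x (delta_mx ord0 i) F (G x)) ->
  (\int[lebesgue_rV n]_x (G x)%:E = 0)%E.
Proof.
elim: n i F G => [|n IHn] i F G cG sF sG dF.
  by case: i dF.
have [iG ->] := integral_lebesgue_rVS (compact_support_integrable cG sG).
have norm1 t y : `|t| <= `|cons_rV (t, y) : 'rV[R]_n.+1|.
  by have := coord_le_norm (cons_rV (t, y)) ord0; rewrite cons_rV0.
have norm2 t (y : 'rV[R]_n) : `|y| <= `|cons_rV (t, y)|.
  apply/norm_rVP => // j; have := coord_le_norm (cons_rV (t, y)) (lift ord0 j).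
  by rewrite cons_rVS.
have cons_cvg t y : continuous (fun s : R => cons_rV (s, y) : 'rV[R]_n.+1) /\
    continuous (fun z : 'rV[R]_n => cons_rV (t, z) : 'rV[R]_n.+1).
  split=> s A /nbhs_ballP[e /= e0 eA]; apply/nbhs_ballP; exists e => //= z bz;
    apply/eA/ball_rVP => // j; case: (unliftP ord0 j) => [k|] ->.
  - by rewrite !cons_rVS subrr normr0.
  - by rewrite !cons_rV0.
  - by rewrite !cons_rVS; exact: (ball_rVP _ _ e0).1.
  - by rewrite !cons_rV0 subrr normr0.
case: (unliftP ord0 i) dF => [j|] -> dF.
  rewrite -integral12_prod_meas1//; apply: integral0_eq => t _.
  rewrite /fubini_F/=.
  apply: (IHn j (fun y => F (cons_rV (t, y))) (fun y => G (cons_rV (t, y)))).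
  - move=> y; apply: continuous_comp; [exact: (cons_cvg t y).2|exact: cG].
  - by move=> y /sF; exact: le_trans.
  - by move=> y /sG; exact: le_trans.
  - move=> y; apply: (@is_derive_line _ _ _ _ (fun y : 'rV[R]_n =>
      cons_rV (t, y) : 'rV[R]_n.+1) _ _
      (delta_mx ord0 (lift ord0 j)) F).
    move=> h; apply/rowP => k; rewrite [RHS]mxE [X in _ = X + _]mxE [X in _ =
      _ * X + _]mxE; case: (unliftP ord0 k) => [l|] ->.
      by rewrite !cons_rVS !mxE/= (inj_eq lift_inj).
    by rewrite !cons_rV0 /= mulr0 add0r.
rewrite -integral21_prod_meas1//; apply: integral0_eq => y _.
rewrite /fubini_G/=.
apply: (integral_derive_line (F := fun t => F (cons_rV (t, y)))).
- move=> t; apply: continuous_comp; [exact: (cons_cvg t y).1|exact: cG].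
- by move=> t /sF; exact: le_trans.
- by move=> t /sG; exact: le_trans.
- move=> t; apply: (@is_derive_line R R _ _ (fun t : R => cons_rV (t,
    y) : 'rV[R]_n.+1) _ _
      (delta_mx ord0 ord0) F).
  move=> h; apply/rowP => k; rewrite [RHS]mxE [X in _ = X + _]mxE [X in _ = _
    * X + _]mxE; case: (unliftP ord0 k) => [l|] ->.
    by rewrite !cons_rVS /= mulr0 add0r.
  by rewrite !cons_rV0.
Qed.

End partial_integral.

(** * Smooth functions and test functions *)

Section smooth_functions.
Context (R : realType) (n : nat).
Implicit Types f g : 'rV[R]_n -> R.

(** Counting the order of differentiability, instead of following a list of directions as [smooth]
    does, lets the Leibniz rule be iterated by induction on [k]. *)
Fixpoint Ck k f := continuous f /\
  if k is k'.+1 then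
    forall i, (forall x, derivable f x (delta_mx ord0 i)) /\ Ck k' (partial i f)
  else True.

Lemma smooth_partial i f : smooth f -> smooth (partial i f).
Proof. by move=> sf s; have := sf (rcons s i); rewrite foldr_rcons. Qed.

Lemma smoothP f : smooth f <-> forall k, Ck k f.
Proof.
split=> [sf k|].
  elim: k f sf => [|k IHk] f sf; split; rewrite /= ?(sf [::]).1//;
    try exact: (sf [::]).1.
  by move=> i; split; [exact: (sf [::]).2|exact/IHk/smooth_partial].
move=> + s; elim/last_ind: s f => [|s i IHs] f Cf; rewrite ?foldr_rcons.
  by split; [exact: (Cf 0%N).1|move=> i; exact: ((Cf 1%N).2 i).1].
by apply: IHs => k; exact: ((Cf k.+1).2 i).2.
Qed.

Lemma Ck_S k f : Ck k.+1 f -> Ck k f.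
Proof.
elim: k f => [|k IHk] f [cf Cf]; split=> // i.
by split; [exact: (Cf i).1|exact/IHk/(Cf i).2].
Qed.

Lemma partialD i f g x : derivable f x (delta_mx ord0 i) ->
  derivable g x (delta_mx ord0 i) ->
  partial i (fun y => f y + g y) x = partial i f x + partial i g x.
Proof. by move=> df dg; rewrite /partial -deriveD. Qed.

Lemma partialM i f g x : derivable f x (delta_mx ord0 i) ->
  derivable g x (delta_mx ord0 i) ->
  partial i (fun y => f y * g y) x = f x * partial i g x + partial i f x * g x.
Proof. by move=> df dg; rewrite /partial (deriveM df dg); congr (_ + _);
  exact: mulrC. Qed.

Lemma CkD k f g : Ck k f -> Ck k g -> Ck k (fun x => f x + g x).
Proof.
elim: k f g => [|k IHk] f g [cf Cf] [cg Cg].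
  by split=> // x; exact: (continuousD (cf x) (cg x)).
split=> [x|i]; first exact: (continuousD (cf x) (cg x)).
split=> [x|]; first by apply: derivableD; [exact: (Cf i).1|exact: (Cg i).1].
rewrite (_ : partial i _ = fun x => partial i f x + partial i g x).
  by apply: IHk; [exact: (Cf i).2|exact: (Cg i).2].
by apply/funext => x; rewrite partialD//; [exact: (Cf i).1|exact: (Cg i).1].
Qed.

Lemma CkM k f g : Ck k f -> Ck k g -> Ck k (fun x => f x * g x).
Proof.
elim: k f g => [|k IHk] f g Ckf Ckg; have [cf Cf] := Ckf; have [cg Cg] := Ckg.
  by split=> // x; exact: (continuousM (cf x) (cg x)).
split=> [x|i]; first exact: (continuousM (cf x) (cg x)).
split=> [x|]; first by apply: derivableM; [exact: (Cf i).1|exact: (Cg i).1].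
rewrite (_ : partial i _ = fun x => f x * partial i g x + partial i f x * g x).
  by apply: CkD; apply: IHk; [exact: Ck_S|exact: (Cg i).2|exact: (Cf
    i).2|exact: Ck_S].
by apply/funext => x; rewrite partialM//; [exact: (Cf i).1|exact: (Cg i).1].
Qed.

Lemma Ck_cst k a : Ck k (fun=> a).
Proof.
elim: k a => [|k IHk] a; split=> //; try exact: cst_continuous.
move=> i.
split=> [x|]; first exact: derivable_cst.
rewrite (_ : partial i _ = fun=> 0); first exact: IHk.
by apply/funext => x; rewrite /partial derive_cst.
Qed.

Lemma smooth_cst a : smooth ((fun=> a) : 'rV[R]_n -> R).
Proof. by apply/smoothP => k; exact: Ck_cst. Qed.

Lemma smoothD f g : smooth f -> smooth g -> smooth (fun x => f x + g x).
Proof. by move=> /smoothP sf /smoothP sg; apply/smoothP => k; exact: CkD. Qed.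

Lemma smoothM f g : smooth f -> smooth g -> smooth (fun x => f x * g x).
Proof. by move=> /smoothP sf /smoothP sg; apply/smoothP => k; exact: CkM. Qed.

Lemma smoothZ a f : smooth f -> smooth (fun x => a * f x).
Proof. by apply: smoothM; exact: smooth_cst. Qed.

Lemma smoothB f g : smooth f -> smooth g -> smooth (fun x => f x - g x).
Proof.
move=> sf /(smoothZ (-1)) sg.
have -> : (fun x => f x - g x) = (fun x => f x + -1 * g x).
  by apply/funext => x; rewrite mulN1r.
exact: smoothD.
Qed.

Lemma smooth_prod (I : Type) (r : seq I) (h : I -> 'rV[R]_n -> R) :
  (forall j, smooth (h j)) -> smooth (fun x => \prod_(j <- r) h j x).
Proof.
move=> sh; elim: r => [|j r IHr].
  have -> : (fun x => \prod_(j <- [::]) h j x) = fun=> 1.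
    by apply/funext => x; rewrite big_nil.
  exact: smooth_cst.
have -> : (fun x => \prod_(i <- j :: r) h i x) =
    fun x => h j x * \prod_(i <- r) h i x.
  by apply/funext => x; rewrite big_cons.
exact: (smoothM (sh j) IHr).
Qed.

Lemma smoothX m f : smooth f -> smooth (fun x => f x ^+ m).
Proof.
move=> sf; elim: m => [|m IHm]; first exact: smooth_cst.
have -> : (fun x => f x ^+ m.+1) = fun x => f x * f x ^+ m.
  by apply/funext => x; rewrite exprS.
exact: (smoothM sf IHm).
Qed.

Lemma smooth_derive f i x : smooth f -> is_derive x (delta_mx ord0 i) f
  (partial i f x).
Proof. by move=> sf; split=> //; exact: (sf [::]).2. Qed.

Lemma smooth_continuous f : smooth f -> continuous f.
Proof. by move=> sf; exact: (sf [::]).1. Qed.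

End smooth_functions.

(** * Smooth functions on the line that vanish on a half-line *)

Section flat_function.
Context (R : realType).
Implicit Types (t : R) (m : nat).

Lemma is_derive1_comp (f g : R -> R) t df dg : is_derive t (1 : R) f df ->
  is_derive (f t) (1 : R) g dg -> is_derive t (1 : R) (g \o f) (dg * df).
Proof.
move=> [df1 dfE] [dg1 dgE].
have /derivable1_diffP df2 := df1; have /derivable1_diffP dg2 := dg1.
split; first exact: (derivable1_diffP _ _).2 (differentiable_comp df2 dg2).
by rewrite -derive1E (derive1_comp df1 dg1) !derive1E dfE dgE.
Qed.

(* The family [t^-m exp(-1/t)] is closed under differentiation up to linear
   combinations, hence consists of smooth functions. *)
Definition flat m t := if 0 < t then t^-1 ^+ m * expR (- t^-1) else 0.

Lemma flat_ge0 m t : 0 <= flat m t.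
Proof.
rewrite /flat; case: ifPn => // t0.
by rewrite mulr_ge0 ?expR_ge0// exprn_ge0// invr_ge0 ltW.
Qed.

Lemma flat0_le1 t : flat 0 t <= 1.
Proof.
rewrite /flat; case: ifPn => // t0.
by rewrite mul1r expR_le1 oppr_le0 invr_ge0 ltW.
Qed.

Lemma flat0_neq0 t : (flat 0 t != 0) = (0 < t).
Proof.
by rewrite /flat; case: ifPn => _; rewrite ?eqxx// mul1r expR_eq0.
Qed.

(** The exponential bound [y^(m+1) / (m+1)! <= exp y] at [y = 1/t]. The right side tends to 0 with
    [t], as the derivative at the origin requires. *)
Lemma flat_bound m t : flat m t <= m.+1`!%:R * `|t|.
Proof.
rewrite /flat; case: ifPn => t0; last by rewrite mulr_ge0.
have y0 : 0 < t^-1 by rewrite invr_gt0.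
rewrite gtr0_norm// expRN ler_pdivrMr ?expR_gt0//.
have := expR_ge1Dxn m (ltW y0); set y := t^-1 in y0 *.
have f0 : 0 < m.+1`!%:R :> R by rewrite ltr0n fact_gt0.
move=> h1; have h : y ^+ m.+1 <= expR y * m.+1`!%:R.
  by rewrite -ler_pdivrMr//; apply: le_trans h1; rewrite lerDr.
have -> : y ^+ m = t * y ^+ m.+1.
  by rewrite exprS mulrA divff ?mul1r// gt_eqF.
rewrite (mulrC _ t) -mulrA; apply: ler_wpM2l; first exact: ltW.
by rewrite [leRHS]mulrC.
Qed.

Lemma is_derive_flat m t :
  is_derive t (1 : R) (flat m) (flat m.+2 t - m%:R * flat m.+1 t).
Proof.
have [t0|t0|->] := ltgtP t 0.
- apply: (@near_eq_is_derive _ _ _ (cst 0)).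
    near=> s; rewrite /flat ifF//; apply/negbTE; rewrite -leNgt ltW//.
    by near: s; exact: lt_nbhsl.
  rewrite /flat ltNge (ltW t0)/= mulr0 subr0; exact: is_derive_cst.
- have t0' : t != 0 by rewrite gt_eqF.
  apply: (@near_eq_is_derive _ _ _
    ((fun s : R => s^-1) ^+ m * (expR \o (fun s : R => - s^-1)))).
    near=> s; rewrite /flat ifT//; last by near: s; exact: lt_nbhsr.
    by rewrite mulrfctE exprfctE.
  have dV : is_derive t (1 : R) (fun s : R => s^-1) (- (t ^- 2)).
    split; first by apply: derivableV.
    by rewrite deriveV// derive_id [LHS]mulr1.
  have dE := is_derive1_comp (is_deriveN dV) (is_derive_expR (- t^-1)).
  apply: (is_derive_eq (is_deriveM (is_deriveX m dV) dE)).
  rewrite ?exprfctE /flat t0 /=; case: (m) => [|k].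
    rewrite !mul0r subr0 scale0r scaler0 addr0 /GRing.scale/= expr0 exprVn;
      ring.
  rewrite /GRing.scale/= -exprVn !exprS; ring.
- have -> : flat m.+2 0 - m%:R * flat m.+1 0 = 0.
    by rewrite /flat ltxx mulr0 subr0.
  have cv : (fun h : R => h^-1 *: ((flat m \o shift 0) (h *: (1 : R)) - flat
    m 0)) @ 0^' --> (0 : R).
    apply/cvgr0Pnorm_le => e e0; near=> h.
    have h0 : h != 0 by near: h; exact: nbhs_dnbhs_neq.
    (* The difference quotient at 0 is the next member of the family, which [flat_bound] sends to
       0. *)
    have -> : h^-1 *: ((flat m \o shift 0) (h *: 1) - flat m 0) = flat m.+1 h.
      rewrite /= /flat ltxx subr0 addr0 [h *: 1]mulr1; case: ifPn => _;
        last exact: scaler0.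
      by rewrite exprS -mulrA.
    rewrite ger0_norm ?flat_ge0// (le_trans (flat_bound _ _))//.
    rewrite mulrC -ler_pdivlMr ?ltr0n ?fact_gt0//.
    by near: h; apply: dnbhs0_le; rewrite divr_gt0// ltr0n fact_gt0.
  split; first by apply/cvg_ex; exists 0.
  exact/cvg_lim.
Unshelve. all: by end_near. Qed.

End flat_function.

(** * Bump functions and approximation of indicators of open sets *)

Section bump.
Context (R : realType) (n : nat).
Implicit Types (c x : 'rV[R]_n) (U : set 'rV[R]_n).

(** The induction on [k] treats all [m] together, since differentiation produces the members [m.+1]
    and [m.+2]. *)
Lemma Ck_flat_coord (s a : R) (i : 'I_n) k m :
  Ck k (fun x : 'rV[R]_n => flat m (s * x ord0 i + a)).
Proof.
have dphi m' (x : 'rV[R]_n) (j : 'I_n) : is_derive x (delta_mx ord0 j)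
    (fun x : 'rV[R]_n => flat m' (s * x ord0 i + a))
    (s * (j == i)%:R * (flat m'.+2 (s * x ord0 i + a) -
                       m'%:R * flat m'.+1 (s * x ord0 i + a))).
  have [/derivable1_diffP df dfE] := is_derive_flat m' (s * x ord0 i + a).
  apply: (@is_derive_line _ _ _ _ (fun x : 'rV[R]_n => s * x ord0 i + a) x
    (delta_mx ord0 j) (s * (j == i)%:R) (flat m')).
    move=> h; rewrite !mxE /= eq_sym /GRing.scale/=; ring.
  split; first exact: diff_derivable.
  rewrite deriveE// -[X in 'd _ _ X]mulr1 linearZ/= -deriveE// dfE.
  by [].
have cf m' : continuous (fun x : 'rV[R]_n => flat m' (s * x ord0 i + a)).
  move=> x; apply: (@continuous_comp _ _ _ (fun x : 'rV[R]_n =>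
    s * x ord0 i + a)).
    apply: continuousD; last exact: cst_continuous.
    by apply: continuousM; [exact: cst_continuous|exact: coord_continuous].
  apply/differentiable_continuous/derivable1_diffP.
  exact: (@ex_derive _ _ _ _ _ _ _ (is_derive_flat m' _)).
elim: k m => [|k IHk] m; split=> // j; split=> [x|].
  exact: (@ex_derive _ _ _ _ _ _ _ (dphi m x j)).
have -> : partial j (fun x : 'rV[R]_n => flat m (s * x ord0 i + a)) =
    fun x => s * (j == i)%:R * (flat m.+2 (s * x ord0 i + a) +
                       (- m%:R) * flat m.+1 (s * x ord0 i + a)).
  apply/funext => x; rewrite /partial (@derive_val _ _ _ _ _ _ _ (dphi m x j)).
  by rewrite mulNr.
apply: CkM; first exact: Ck_cst.
by apply: CkD => //; apply: CkM => //; exact: Ck_cst.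
Qed.

(** Balls of the sup norm are boxes, so a product over the coordinates can be positive exactly on
    the ball. The guard on [r] settles dimension 0, where the empty product is 1 while a ball of
    nonpositive radius is empty. *)
Definition bump c (r : R) x : R := if 0 < r then
  \prod_(i < n) (flat 0 (x ord0 i + (r - c ord0 i)) *
                 flat 0 ((-1) * x ord0 i + (r + c ord0 i))) else 0.

Lemma bump_smooth c r : smooth (bump c r).
Proof.
rewrite /bump; case: (0 < r); last exact: smooth_cst.
apply: smooth_prod => i; apply: smoothM; apply/smoothP => k;
  last exact: Ck_flat_coord.
have := @Ck_flat_coord 1 (r - c ord0 i) i k 0.
by under eq_fun do rewrite mul1r.
Qed.

Lemma bump_ge0 c r x : 0 <= bump c r x.
Proof.
rewrite /bump; case: ifPn => // _.
by apply: prodr_ge0 => i _; rewrite mulr_ge0 ?flat_ge0.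
Qed.

Lemma bump_le1 c r x : bump c r x <= 1.
Proof.
rewrite /bump; case: ifPn => // _; apply: prodr_ile1 => i _.
by rewrite mulr_ge0 ?flat_ge0// mulr_ile1 ?flat_ge0 ?flat0_le1.
Qed.

Lemma bump_neq0 c r x : (bump c r x != 0) <-> ball c r x.
Proof.
rewrite /bump; case: ifPn => r0; last first.
  by rewrite eqxx; split=> // -[/= r1]; rewrite r1 in r0.
rewrite (ball_rVP _ _ r0) prodf_seq_neq0; split.
  move=> /allP h i; have := h i (mem_index_enum _) => /=.
  rewrite mulf_eq0 negb_or !flat0_neq0 => /andP[h1 h2].
  by rewrite ltr_norml; apply/andP; split; lra.
move=> h; apply/allP => i _ /=; rewrite mulf_eq0 negb_or !flat0_neq0.
by have := h i; rewrite ltr_norml => /andP[h1 h2]; apply/andP; split; lra.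
Qed.

Lemma test_functionI (Omega : set 'rV[R]_n) (phi : 'rV[R]_n -> R) K :
  smooth phi -> compact K -> K `<=` Omega ->
  (forall x, phi x != 0 -> K x) -> test_function Omega phi.
Proof.
move=> sphi cK KO sK.
have clK : closure [set x | phi x != 0] `<=` K.
  have /closure_id -> : closed K.
    by apply: compact_closed => //; exact: norm_hausdorff.
  exact: closureS.
split=> //; last exact: subset_trans KO.
by apply: subclosed_compact clK => //; exact: closed_closure.
Qed.

(* [phi m] is [1 - \prod_(k < m) (1 - B_k)^m], where [U] is a countable union
   of balls and [B_k] is a bump function, with values in [0, 1], of the k-th. *)
Lemma indicator_approx U : open U -> exists phi : nat -> 'rV[R]_n -> R,
  [/\ forall m, test_function U (phi m),
      forall m x, 0 <= phi m x <= 1 &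
      forall x, phi m x @[m --> \oo] --> (\1_U x : R)].
Proof.
move=> /open_bigcup_ball[c [r [UE sub]]].
pose B k x := bump (c k) (r k) x.
have B1 k x : 0 <= 1 - B k x <= 1.
  by rewrite subr_ge0 bump_le1 lerBlDr lerDl bump_ge0.
pose P m x := \prod_(k < m) (1 - B k x) ^+ m.
have P1 m x : 0 <= P m x <= 1.
  rewrite prodr_ge0 ?prodr_ile1//= => k _; have /andP[? ?] := B1 k x.
    by rewrite exprn_ge0// exprn_ile1.
  by rewrite exprn_ge0.
exists (fun m x => 1 - P m x); split=> [m|m x|x].
(* The support lies in the finite union of the closed boxes of index below [m] and positive
   radius. *)
- have [K [cK KU BK]] : exists K, [/\ compact K, K `<=` U &
      forall k x, (k < m)%N -> B k x != 0 -> K x].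
    elim: m => [|m [K [cK KU BK]]]; first by exists set0; split => //;
      exact: compact0.
    have [r0|r0] := ltP 0 (r m); last first.
      exists K; split=> // k x; rewrite ltnS leq_eqVlt => /predU1P[->|];
        last exact: BK.
      by rewrite /B /bump ltNge r0 eqxx.
    exists (K `|` [set x | forall i, `|c m ord0 i - x ord0 i| <= r m]); split.
    + apply: compactU => //.
      have := @rV_compact R n (fun i => `[c m ord0 i - r m,
        c m ord0 i + r m]%classic)
        (fun i => @segment_compact R _ _).
      congr compact; apply/seteqP; split=> x /= h i; have := h i.
        by rewrite in_itv/= ler_norml => /andP[? ?]; apply/andP; split; lra.
      by rewrite in_itv/= ler_norml => /andP[? ?]; apply/andP; split; lra.
    + by move=> x [/KU//|]; exact: sub.
    + move=> k x; rewrite ltnS leq_eqVlt => /predU1P[->|km].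
        move=> /bump_neq0/(ball_rVP _ _ r0) h; right => i; exact/ltW/h.
      by move=> Bx; left; exact: BK Bx.
  apply: test_functionI cK KU _.
    apply: smoothB; first exact: smooth_cst.
    apply: smooth_prod => k; apply: smoothX; apply: smoothB;
      first exact: smooth_cst.
    exact: bump_smooth.
  move=> x; apply: contraNP => Kx; rewrite /P big1 ?subrr// => k _.
  suff -> : B k x = 0 by rewrite subr0 expr1n.
  by apply/eqP; apply: contra_notT Kx => /(BK k x); exact.
- have /andP[? ?] := P1 m x; apply/andP; split; lra.
- rewrite indicE; case: (boolP (x \in U)) => [|/negP Ux]; last first.
    have -> : (fun m => 1 - P m x) = fun=> 0; last exact: cvg_cst.
    apply/funext => m; rewrite /P big1 ?subrr// => k _.
    suff -> : B k x = 0 by rewrite subr0 expr1n.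
    apply/eqP; apply: contra_notT Ux => /bump_neq0 bx.
    by rewrite inE UE; exists k.
  rewrite inE UE => -[k _ /bump_neq0 bk].
  rewrite -[X in _ --> X]subr0; apply: cvgB; first exact: cvg_cst.
  have Bk0 : 0 < B k x by rewrite lt_neqAle eq_sym bk bump_ge0.
  have /andP[? ?] := B1 k x.
  (* For [m > k] the product is at most its [k]-th factor, and the exponent [m] sends this factor to
     0 however small [B k x > 0] is. *)
  apply: (@squeeze_cvgr _ _ _ _ (fun=> 0) (fun m => (1 - B k x) ^+ m)).
  + near=> m; have /andP[-> _] := P1 m x => /=.
    have km : (k < m)%N by near: m; exact: nbhs_infty_gt.
    rewrite /P (bigD1 (Ordinal km))//= ler_piMr ?exprn_ge0//.
    apply: prodr_ile1 => j _; have /andP[? ?] := B1 j x.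
    by rewrite exprn_ge0//= exprn_ile1.
  + exact: cvg_cst.
  + rewrite exprn_geometric; apply: cvg_geometric.
    by rewrite ger0_norm// ltrBlDr ltrDl.
Unshelve. all: by end_near. Qed.

Lemma test_functionS (U Omega : set 'rV[R]_n) phi : U `<=` Omega ->
  test_function U phi -> test_function Omega phi.
Proof. by move=> UO [sphi cphi pU]; split=> //; exact: subset_trans UO. Qed.

End bump.

(** Identities obtained in the limit along test functions are closed by this lemma, with [K] a fixed
    quantity. *)
Lemma eq0_of_sqr_le (R : realFieldType) (x K : R) :
  (forall e : R, 0 < e -> x ^+ 2 <= e * K) -> x = 0.
Proof.
move=> h; apply/eqP/negPn/negP => x0.
have x2 : 0 < x ^+ 2 by rewrite exprn_even_gt0.
have K0 : 0 < `|K| + 1 by rewrite ltr_wpDl.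
(* This choice of [e] makes the bound at most half of [x ^+ 2]. *)
have := h (x ^+ 2 / (2 * (`|K| + 1))).
rewrite divr_gt0// ?mulr_gt0// => /(_ isT).
rewrite mulrAC ler_pdivlMr ?mulr_gt0//; have := ler_norm K; nra.
Qed.

(** * The space L^2 of the domain *)

Section L2_domain.
Context (R : realType) (n : nat) (Omega : set 'rV[R]_n).
Hypothesis mO : measurable Omega.
Local Notation leb := (lebesgue_rV n).
Local Notation L2 := (L2 Omega).
Implicit Types u v w : 'rV[R]_n -> R.

Definition innerO u v : R := \int[leb]_(x in Omega) (u x * v x).

Lemma innerOE u v : innerO u v = inner leb (u \_ Omega) (v \_ Omega).
Proof.
rewrite /innerO Rintegral_mkcond; apply: eq_Rintegral => x _.
by rewrite !patchE; case: (x \in Omega) => //; rewrite mulr0.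
Qed.

Lemma L2D u v : L2 u -> L2 v -> L2 (fun x => u x + v x).
Proof.
move=> hu hv; rewrite /Defs.L2.
have -> : (fun x => u x + v x) \_ Omega = fun x =>
  (u \_ Omega) x + (v \_ Omega) x.
  by apply/funext => x; rewrite !patchE; case: (x \in Omega) => //;
    rewrite addr0.
exact: Lfun2D.
Qed.

Lemma L2Z a u : L2 u -> L2 (fun x => a * u x).
Proof.
move=> hu; rewrite /Defs.L2.
have -> : (fun x => a * u x) \_ Omega = fun x => a * (u \_ Omega) x.
  by apply/funext => x; rewrite !patchE; case: (x \in Omega) => //;
    rewrite mulr0.
exact: Lfun2Z.
Qed.

Lemma L2B u v : L2 u -> L2 v -> L2 (fun x => u x - v x).
Proof.
move=> hu hv; rewrite /Defs.L2.
have -> : (fun x => u x - v x) \_ Omega = fun x =>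
  (u \_ Omega) x - (v \_ Omega) x.
  by apply/funext => x; rewrite !patchE; case: (x \in Omega) => //;
    rewrite subr0.
exact: Lfun2B.
Qed.

Lemma innerOC u v : innerO u v = innerO v u.
Proof. by rewrite !innerOE innerC. Qed.

Lemma innerO_ge0 u : 0 <= innerO u u.
Proof. by rewrite innerOE inner_ge0. Qed.

Lemma innerO_integrable u v : L2 u -> L2 v ->
  leb.-integrable Omega (EFin \o (fun x => u x * v x)).
Proof.
move=> hu hv; apply/integrable_mkcond => //.
have -> : (EFin \o (fun x => u x * v x)) \_ Omega =
    EFin \o (fun x => (u \_ Omega) x * (v \_ Omega) x).
  by apply/funext => x; rewrite /= !patchE; case: (x \in Omega) => //=;
    rewrite mulr0.
exact: inner_integrable.
Qed.

Lemma innerODl u v w : L2 u -> L2 v -> L2 w ->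
  innerO (fun x => u x + v x) w = innerO u w + innerO v w.
Proof.
move=> hu hv hw; rewrite /innerO -RintegralD//; [|exact: innerO_integrable..].
by apply: eq_Rintegral => x _; rewrite mulrDl.
Qed.

Lemma innerOZl a u w : L2 u -> L2 w -> innerO (fun x =>
  a * u x) w = a * innerO u w.
Proof.
move=> hu hw; rewrite /innerO -RintegralZl//; last exact: innerO_integrable.
by apply: eq_Rintegral => x _; rewrite mulrA.
Qed.

Lemma innerOBl u v w : L2 u -> L2 v -> L2 w ->
  innerO (fun x => u x - v x) w = innerO u w - innerO v w.
Proof.
move=> hu hv hw; rewrite /innerO -RintegralB//; [|exact: innerO_integrable..].
by apply: eq_Rintegral => x _; rewrite mulrBl.
Qed.

Lemma innerODr u v w : L2 u -> L2 v -> L2 w ->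
  innerO w (fun x => u x + v x) = innerO w u + innerO w v.
Proof. by move=> hu hv hw; rewrite innerOC innerODl// ![innerO _ w]innerOC. Qed.

Lemma innerOZr a u w : L2 u -> L2 w -> innerO w (fun x =>
  a * u x) = a * innerO w u.
Proof. by move=> hu hw; rewrite innerOC innerOZl// innerOC. Qed.

Lemma innerOBr u v w : L2 u -> L2 v -> L2 w ->
  innerO w (fun x => u x - v x) = innerO w u - innerO w v.
Proof. by move=> hu hv hw; rewrite innerOC innerOBl// ![innerO _ w]innerOC. Qed.

Lemma innerO_CS u v : L2 u -> L2 v -> innerO u v ^+ 2 <= innerO u u * innerO
  v v.
Proof. by move=> hu hv; rewrite !innerOE; exact: inner_CS. Qed.

Lemma innerO_eq0 u : L2 u -> innerO u u = 0 -> ae_eq leb Omega u (cst 0).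
Proof.
rewrite innerOE => hu /(inner_eq0 hu); apply: filterS => x; rewrite patchE.
by move=> + Ox; rewrite mem_set.
Qed.

Lemma eq_innerO u u' v v' : L2 u -> L2 u' -> L2 v -> L2 v' ->
  ae_eq leb Omega u u' -> ae_eq leb Omega v v' -> innerO u v = innerO u' v'.
Proof.
move=> hu hu' hv hv' uu' vv'; rewrite /innerO /Rintegral; congr fine.
apply: ae_eq_integral => //.
- exact: measurable_int (innerO_integrable hu hv).
- exact: measurable_int (innerO_integrable hu' hv').
by apply: filterS2 uu' vv' => x ux vx Ox; rewrite ux// vx.
Qed.

(** Completeness on the whole space applies to the extensions by 0; cutting the limit off outside
    [Omega] does not increase its distance to them. *)
Lemma L2_complete_on (u : nat -> 'rV[R]_n -> R) : (forall k, L2 (u k)) ->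
  (forall e : R, 0 < e -> exists N, forall i j, (N <= i)%N -> (N <= j)%N ->
    innerO (fun x => u i x - u j x) (fun x => u i x - u j x) <= e) ->
  exists2 w, L2 w & forall e : R, 0 < e -> exists N, forall i, (N <= i)%N ->
    innerO (fun x => w x - u i x) (fun x => w x - u i x) <= e.
Proof.
move=> hu uC; have E (v v' : 'rV[R]_n -> R) : (fun x => v x - v' x) \_ Omega =
    fun x => (v \_ Omega) x - (v' \_ Omega) x.
  by apply/funext => x; rewrite !patchE; case: (x \in Omega) => //;
    rewrite subr0.
have [e e0|w hw wC] := @L2_complete _ _ _ leb (fun k => u k \_ Omega) hu.
  have [N hN] := uC e e0; exists N => i j Ni Nj.
  by have := hN i j Ni Nj; rewrite innerOE E.
have wO : L2 (w \_ Omega).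
  rewrite /Defs.L2 (_ : _ \_ _ = w \_ Omega); last first.
    by apply/funext => x; rewrite !patchE; case: (x \in Omega).
  have [mw iw] := (Lfun2P _ _).1 hw; apply/Lfun2P; split.
    by apply/(measurable_restrictT _ _).1 => //; exact: measurable_funTS.
  have : leb.-integrable Omega (EFin \o (fun x => w x ^+ 2)).
    exact: integrableS iw.
  have -> : EFin \o (fun x => (w \_ Omega) x ^+ 2) =
      (EFin \o (fun x => w x ^+ 2)) \_ Omega.
    by apply/funext => x; rewrite /= !patchE; case: (x \in Omega) => //=;
      rewrite expr0n.
  by move/integrable_mkcond => /(_ mO).
exists (w \_ Omega) => // e e0.
have [N hN] := wC e e0; exists N => i Ni; apply: le_trans (hN i Ni).
have wui : (fun x => w x - (u i \_ Omega) x) \in Lfun leb 2%:E.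
  exact: (Lfun2B hw (hu i)).
rewrite -lee_fin innerOE EFin_inner; last exact: (L2B wO (hu i)).
rewrite EFin_inner//; apply: ge0_le_integral => //.
- by move=> x _; rewrite lee_fin sqr_ge0.
- apply/measurable_EFinP/measurable_funX.
  by have [] := (Lfun2P _ _).1 (L2B wO (hu i)).
- by apply/measurable_EFinP/measurable_funX; have [] := (Lfun2P _ _).1 wui.
- move=> x _; rewrite lee_fin !patchE; case: (x \in Omega) => //.
  by rewrite expr0n sqr_ge0.
Qed.

End L2_domain.

(** * Test functions: integration by parts and the Poincare inequality *)

Section test_functions.
Context (R : realType) (n : nat) (Omega : set 'rV[R]_n).
Hypothesis oO : open Omega.
Variable M : R.
Hypothesis OM : forall x, Omega x -> `|x| <= M.
Local Notation leb := (lebesgue_rV n).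
Local Notation L2 := (L2 Omega).
Local Notation innerO := (innerO Omega).
Local Notation test := (test_function Omega).
Implicit Types (u v g : 'rV[R]_n -> R) (phi psi : 'rV[R]_n -> R).

Let mO : measurable Omega. Proof. exact: open_measurable_rV. Qed.

Lemma test_out phi x : test phi -> phi x != 0 -> Omega x.
Proof. by case=> _ _ sO phix; apply: sO; exact: subset_closure. Qed.

Lemma test_smooth phi : test phi -> smooth phi. Proof. by case. Qed.

Lemma test_le phi x : test phi -> phi x != 0 -> `|x| <= M.
Proof. by move=> tphi /(test_out tphi)/OM. Qed.

Lemma testE phi : test phi -> phi \_ Omega = phi.
Proof.
move=> tphi; apply/funext => x; rewrite patchE; case: ifPn => // /negP Ox.
by apply/esym/eqP; apply: contra_notT Ox => /(test_out tphi); rewrite inE.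
Qed.

Lemma test_mul phi psi : smooth phi -> test psi ->
  test (fun x => phi x * psi x).
Proof.
move=> sphi [spsi cpsi sO]; apply: test_functionI cpsi sO _;
  first exact: smoothM.
by move=> x; rewrite mulf_eq0 negb_or => /andP[_ ?]; exact: subset_closure.
Qed.

Lemma test_partial i phi : test phi -> test (partial i phi).
Proof.
move=> [sphi cphi sO]; apply: test_functionI cphi sO _;
  first exact: smooth_partial.
move=> x; apply: contraNP => xK.
rewrite /partial (@near_eq_derive _ _ _ _ (cst 0)) ?derive_cst//.
have : nbhs x (~` closure [set x | phi x != 0]).
  by apply: open_nbhs_nbhs; split=> //; exact/closed_openC/closed_closure.
apply: filterS => y yK; apply/eqP; apply: contra_notT yK => phiy.
exact: (@subset_closure _ [set x | phi x != 0]).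
Qed.

Lemma testD phi psi : test phi -> test psi -> test (fun x => phi x + psi x).
Proof.
move=> [sphi cphi pO] [spsi cpsi qO].
apply: (test_functionI (K := closure [set x | phi x != 0] `|` closure [set x
  | psi x != 0])).
- exact: smoothD.
- exact: compactU.
- by move=> x [/pO|/qO].
move=> x h; have [p0|p0] := eqVneq (phi x) 0; last by left;
  exact: subset_closure.
by right; apply: subset_closure; move: h; rewrite p0 add0r.
Qed.

Lemma testZ a phi : test phi -> test (fun x => a * phi x).
Proof. by apply: test_mul; exact: smooth_cst. Qed.

Lemma testB phi psi : test phi -> test psi -> test (fun x => phi x - psi x).
Proof.
move=> tphi /(testZ (-1)) tpsi.
have -> : (fun x => phi x - psi x) = (fun x => phi x + -1 * psi x).
  by apply/funext => x; rewrite mulN1r.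
exact: testD.
Qed.

Lemma partial_testD i phi psi : test phi -> test psi ->
  partial i (fun x => phi x + psi x) = fun x =>
    partial i phi x + partial i psi x.
Proof.
move=> /test_smooth sp /test_smooth sq; apply/funext => x.
by apply: partialD; [exact: (sp [::]).2|exact: (sq [::]).2].
Qed.

Lemma partial_testZ i a phi : test phi ->
  partial i (fun x => a * phi x) = fun x => a * partial i phi x.
Proof.
move=> /test_smooth sp; apply/funext => x.
rewrite partialM; [|exact: derivable_cst|exact: (sp [::]).2].
by rewrite /partial derive_cst mul0r addr0.
Qed.

Lemma partial_testB i phi psi : test phi -> test psi ->
  partial i (fun x => phi x - psi x) = fun x =>
    partial i phi x - partial i psi x.
Proof.
move=> tp tq; have -> : (fun x => phi x - psi x) = (fun x =>
  phi x + -1 * psi x).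
  by apply/funext => x; rewrite mulN1r.
rewrite partial_testD//; last exact: testZ.
by rewrite partial_testZ//; apply/funext => x; rewrite mulN1r.
Qed.

Lemma test_integrable phi : test phi -> leb.-integrable setT (EFin \o phi).
Proof.
move=> tp; apply: (@compact_support_integrable _ _ _ M).
  exact/smooth_continuous/test_smooth.
by move=> x; exact: test_le.
Qed.

Lemma test_L2 phi : test phi -> L2 phi.
Proof.
move=> tp; rewrite /Defs.L2 testE//; apply/Lfun2P; split.
  exact: (continuous_measurable_rV (smooth_continuous (test_smooth tp))).
have /test_integrable := test_mul (test_smooth tp) tp.
by under eq_fun do rewrite -expr2.
Qed.

Lemma innerO_test phi psi : test psi ->
  innerO phi psi = \int[leb]_x (phi x * psi x).
Proof.
move=> tp; rewrite /innerO Rintegral_mkcond; apply: eq_Rintegral => x _.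
rewrite patchE; case: ifPn => // /negP Ox.
suff -> : psi x = 0 by rewrite mulr0.
by apply/eqP; apply: contra_notT Ox => /(test_out tp); rewrite inE.
Qed.

(** The product [phi * psi] inherits the compact support of [psi], so the integral of its partial
    derivative vanishes. *)
Lemma test_by_parts i phi psi : smooth phi -> test psi ->
  innerO phi (partial i psi) = - innerO (partial i phi) psi.
Proof.
move=> sp tq; have sq := test_smooth tq.
have tpq := test_mul sp tq.
have tp' := test_partial i tpq.
have tdq := test_partial i tq.
apply/eqP; rewrite -addr_eq0 (innerO_test _ tdq) (innerO_test _ tq).
rewrite -RintegralD//; last 2 first.
- exact: (test_integrable (test_mul sp tdq)).
- exact: (test_integrable (test_mul (smooth_partial i sp) tq)).
rewrite /Rintegral.
rewrite (_ : (\int[leb]_x _)%E = (\int[leb]_x (partial i (fun x =>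
  phi x * psi x) x)%:E)%E).
  have dpq x := smooth_derive i x (test_smooth tpq).
  rewrite (integral_partial_eq0 (M := M) _ _ _ dpq)//.
  - exact: (smooth_continuous (test_smooth tp')).
  - by move=> x; exact: (test_le tpq).
  - by move=> x; exact: (test_le tp').
apply: eq_integral => x _; congr EFin; rewrite partialM//;
  first exact: (sp [::]).2.
exact: (sq [::]).2.
Qed.

Lemma smooth_coord (i : 'I_n) : smooth (fun x : 'rV[R]_n => x ord0 i).
Proof.
apply/smoothP => -[|k]; split=> //; try exact: coord_continuous.
move=> j; have dE x : is_derive x (delta_mx ord0 j) (fun x : 'rV[R]_n =>
  x ord0 i)
    ((j == i)%:R : R).
  apply: (@is_derive_line _ _ _ _ (fun x : 'rV[R]_n => x ord0 i) x
    (delta_mx ord0 j) ((j == i)%:R) id).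
  by move=> h; rewrite !mxE /= eq_sym.
split=> [x|]; first exact: (@ex_derive _ _ _ _ _ _ _ (dE x)).
have -> : partial j (fun x : 'rV[R]_n => x ord0 i) = fun=> (j == i)%:R.
  by apply/funext => x; exact: (@derive_val _ _ _ _ _ _ _ (dE x)).
exact: Ck_cst.
Qed.

Lemma partial_coord (i : 'I_n) : partial i (fun x : 'rV[R]_n =>
  x ord0 i) = fun=> 1.
Proof.
apply/funext => x.
have dE : is_derive x (delta_mx ord0 i) (fun x : 'rV[R]_n => x ord0 i) (1 : R).
  apply: (@is_derive_line _ _ _ _ (fun x : 'rV[R]_n => x ord0 i) x
    (delta_mx ord0 i) 1 id).
  by move=> h; rewrite !mxE /= eqxx.
exact: (@derive_val _ _ _ _ _ _ _ dE).
Qed.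

(* Integrate [phi^2 * partial i x_i] by parts. *)
Lemma test_Poincare (i : 'I_n) phi : test phi ->
  innerO phi phi <= 4 * M ^+ 2 * innerO (partial i phi) (partial i phi).
Proof.
move=> tp; have sp := test_smooth tp.
pose xp (x : 'rV[R]_n) : R := x ord0 i * phi x.
have txp : test xp by apply: (test_mul (smooth_coord i)).
have tdp := test_partial i tp.
have E : innerO phi phi = - 2 * innerO xp (partial i phi).
  have := test_by_parts i (test_smooth txp) tp.
  have -> : partial i xp = fun x => phi x + x ord0 i * partial i phi x.
    apply/funext => x; rewrite /xp partialM ?partial_coord ?mul1r;
      first exact: addrC.
      exact: (smooth_coord i [::]).2.
    exact: (sp [::]).2.
  have txdp : test (fun x => x ord0 i * partial i phi x).
    exact: (test_mul (smooth_coord i) tdp).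
  rewrite innerODl//; [|exact: test_L2..].
  have -> : innerO (fun x => x ord0 i * partial i phi x) phi = innerO xp
    (partial i phi).
    by apply: eq_Rintegral => x _; rewrite /xp; ring.
  lra.
have xpM : innerO xp xp <= M ^+ 2 * innerO phi phi.
  rewrite /innerO -RintegralZl//; last exact: (innerO_integrable mO (test_L2
    tp) (test_L2 tp)).
  apply: le_Rintegral => //.
  - exact: (innerO_integrable mO (test_L2 txp) (test_L2 txp)).
  - have := innerO_integrable mO (test_L2 (testZ (M ^+ 2) tp)) (test_L2 tp).
    by under eq_fun do rewrite /= -mulrA.
  move=> x Ox; have := le_trans (coord_le_norm x i) (OM Ox); rewrite /xp.
  rewrite ler_norml => /andP[? ?]; rewrite mulrACA -!expr2 ler_wpM2r ?sqr_ge0//.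
  by rewrite -subr_ge0 subr_sqr mulr_ge0//; lra.
have CS := innerO_CS (test_L2 txp) (test_L2 tdp).
have := innerO_ge0 Omega phi; have := innerO_ge0 Omega (partial i phi).
set a := innerO phi phi in E xpM *; set d := innerO (partial i phi) _ in CS *.
set c := innerO xp (partial i phi) in E CS; set e := innerO xp xp in xpM CS.
move=> d0 a0.
have [->|a1] := eqVneq a 0; first by rewrite mulr_ge0// mulr_ge0// sqr_ge0.
have {a1} a1 : 0 < a by rewrite lt_neqAle eq_sym a1.
(* By [E], Cauchy-Schwarz and [xpM], [a * a = 4 * c ^+ 2 <= 4 * e * d <= 4 * M ^+ 2 * a * d]; one
   factor [a] is then cancelled. *)
have : a * a <= a * (4 * M ^+ 2 * d).
  have -> : a * a = 4 * c ^+ 2 by rewrite E; ring.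
  have : e * d <= M ^+ 2 * a * d by rewrite ler_wpM2r.
  by lra.
by rewrite ler_pM2l.
Qed.

End test_functions.

(** * The fundamental lemma of the calculus of variations *)

Section fundamental_lemma.
Context (R : realType) (n : nat) (Omega : set 'rV[R]_n).
Hypothesis oO : open Omega.
Variable M : R.
Hypothesis OM : forall x, Omega x -> `|x| <= M.
Local Notation leb := (lebesgue_rV n).

Let mO : measurable Omega. Proof. exact: open_measurable_rV. Qed.

(** Test functions with values in [0, 1] approximate the indicator of the part of an open set lying
    in [Omega]. By dominated convergence the extension of [g] by 0 has integral 0 over every open
    set, and by Dynkin's theorem over every Borel set. *)
Lemma fundamental_lemma g : L2 Omega g ->
  (forall phi, test_function Omega phi -> innerO Omega g phi = 0) ->
  ae_eq leb Omega g (cst 0).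
Proof.
move=> hg g0; pose h : 'rV[R]_n -> \bar R := EFin \o (g \_ Omega).
have hO x : h x = ((EFin \o g) \_ Omega) x.
  by rewrite /h /= !patchE; case: (x \in Omega).
pose one : 'rV[R]_n -> R := cst 1.
(* [Omega] has finite measure; pairing [g] with the constant 1 makes it integrable, which provides
   the dominating function. *)
have h1 : L2 Omega one.
  rewrite /Defs.L2; apply/Lfun2P; split.
    by apply/(measurable_restrictT _ _).1 => //; exact: measurable_cst.
  have -> : EFin \o (fun x => (one \_ Omega) x ^+ 2) = (EFin \o one) \_ Omega.
    by apply/funext => x; rewrite /= !patchE; case: (x \in Omega);
      rewrite /= ?expr1n ?expr0n.
  apply/(integrable_mkcond _ mO).1.
  have fO : (leb Omega < +oo)%E.
    apply: le_lt_trans (lebesgue_rV_bounded n M); apply: le_measure;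
      rewrite ?inE//.
    exact: measurable_norm_le.
  apply: measurable_bounded_integrable => //; first exact: measurable_cst.
  by exists 1; split=> // y y1 x _; rewrite /one /= normr1 ltW.
have ih : leb.-integrable setT h.
  have -> : h = (EFin \o g) \_ Omega by apply/funext.
  apply/(integrable_mkcond _ mO).1.
  have := innerO_integrable mO hg h1.
  by under eq_fun do rewrite /= mulr1.
have mh := measurable_int _ ih.
have openP : forall U, open U -> (\int[leb]_(x in U) h x = 0)%E.
  move=> U oU; have [phi [tphi phi1 phicvg]] := indicator_approx (openI oU oO).
  have tphi' m : test_function Omega (phi m) by apply: test_functionS (tphi
    m) => x [].
  have mphi m : measurable_fun setT (phi m).
    exact: (continuous_measurable_rV (smooth_continuous (test_smooth (tphi'
      m)))).
  have [|||||_ _] := @dominated_convergence _ _ R leb setT measurableT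
    (fun m x => h x * (phi m x)%:E)%E (fun x =>
      h x * (\1_(U `&` Omega) x)%:E)%E (abse \o h).
  - by move=> m; apply: emeasurable_funM => //; exact/measurable_EFinP.
  - apply: emeasurable_funM => //; apply/measurable_EFinP.
    by apply: measurable_indic; apply: measurableI => //;
      exact: open_measurable_rV.
  - apply: aeW => x _; apply: cvgeZl; first by rewrite /h.
    by apply: cvg_EFin; [exact: nearW|exact: phicvg].
  - exact: integrable_abse.
  - apply: aeW => x m _; rewrite abseM -[leRHS]mule1 lee_wpmul2l//.
    have /andP[? ?] := phi1 m x.
    by rewrite /= ger0_norm.
  have -> : [sequence (\int[leb]_x (h x * (phi m x)%:E))%E]_m = cst 0%E.
    apply/funext => m /=.
    transitivity (innerO Omega g (phi m))%:E; last by rewrite g0.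
    rewrite /innerO /Rintegral fineK; last first.
      apply: integrable_fin_num => //.
      exact: (innerO_integrable mO hg (test_L2 OM (tphi' m))).
    rewrite [RHS]integral_mkcond; apply: eq_integral => x _.
    by rewrite /h /= !patchE; case: (x \in Omega); rewrite /= ?mul0e// -EFinM.
  move=> c0; rewrite integral_mkcond; apply: etrans (cvg_unique _ c0 (cvg_cst
    _)) => //.
  apply: eq_integral => x _; rewrite indicE in_setI patchE !hO !patchE.
  by case: (x \in U) => /=; case: (x \in Omega);
    rewrite ?mulr1n ?mulr0n ?mule1 ?mule0.
suff H : forall E, <<s @open 'rV[R]_n >> E -> (\int[leb]_(x in E) h x = 0)%E.
  have : ae_eq leb setT h (cst 0%E).
    apply: integral_ae_eq => // E _ mE.
    by rewrite H ?integral0// -measurable_rV_open.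
  apply: filterS => x /(_ I) + Ox; by rewrite /h /= patchE mem_set// => -[].
apply: (@dynkin_induction _ _ (@open 'rV[R]_n)
  (fun E => \int[leb]_(x in E) h x = 0)%E).
- exact: measurable_rV_open.
- by move=> A B; exact: openI.
- by apply: openP; exact: openT.
- by move=> U oU; exact: openP.
- move=> S mS S0; have := @integral_setU _ _ R leb S (~` S) h mS (measurableC
    mS).
  rewrite setUv => /(_ mh); rewrite S0 add0e (openP setT openT) => <-//.
  by apply/disj_set2P; rewrite setICr.
- move=> F mF tF F0; rewrite integral_bigcup//; last first.
    by apply: integrableS ih => //; exact: bigcupT_measurable.
  by apply: eseries0 => k _ _; exact: F0.
Qed.

End fundamental_lemma.

(** * Weak gradients and the Poisson problem *)

Section weak_gradient.
Context (R : realType) (n : nat) (Omega : set 'rV[R]_n).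
Hypothesis oO : open Omega.
Variable M : R.
Hypothesis OM : forall x, Omega x -> `|x| <= M.
Local Notation leb := (lebesgue_rV n).
Local Notation L2 := (L2 Omega).
Local Notation innerO := (innerO Omega).
Local Notation test := (test_function Omega).
Implicit Types (u v : 'rV[R]_n -> R) (g h : 'I_n -> 'rV[R]_n -> R).

Let mO : measurable Omega. Proof. exact: open_measurable_rV. Qed.

Definition is_weak_gradient u g := forall i, weak_partial_of Omega i u (g i).

Definition innerG g h : R := \sum_i innerO (g i) (h i).

Definition grad (phi : 'rV[R]_n -> R) i := partial i phi.

(** The parallelogram law, with the squared norm of [a u - b v] dropped. *)
Lemma innerO_lin_le a b u v : L2 u -> L2 v ->
  innerO (fun x => a * u x + b * v x) (fun x => a * u x + b * v x) <=
  2 * a ^+ 2 * innerO u u + 2 * b ^+ 2 * innerO v v.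
Proof.
move=> hu hv; have hau := L2Z a hu; have hbv := L2Z b hv.
have := innerO_ge0 Omega (fun x => a * u x - b * v x).
rewrite innerOBl//; last exact: L2B.
rewrite !innerOBr// innerODl//; last exact: L2D.
rewrite !innerODr// !innerOZl// !innerOZr// [innerO v u]innerOC; lra.
Qed.

Lemma innerG_ge0 g : 0 <= innerG g g.
Proof. by apply: sumr_ge0 => i _; exact: innerO_ge0. Qed.

Lemma innerGC g h : innerG g h = innerG h g.
Proof. by apply: eq_bigr => i _; exact: innerOC. Qed.

Lemma innerO_le_innerG i g : innerO (g i) (g i) <= innerG g g.
Proof. by rewrite /innerG (bigD1 i)//= lerDl sumr_ge0// => j _;
  exact: innerO_ge0. Qed.

Section innerG.
Variables g h k : 'I_n -> 'rV[R]_n -> R.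
Hypotheses (hg : forall i, L2 (g i)) (hh : forall i,
  L2 (h i)) (hk : forall i, L2 (k i)).

Lemma innerG_linl a b : innerG (fun i x => a * g i x + b * h i x) k =
  a * innerG g k + b * innerG h k.
Proof.
rewrite /innerG !mulr_sumr -big_split; apply: eq_bigr => i _ /=.
by rewrite innerODl ?innerOZl//; exact: L2Z.
Qed.

Lemma innerGBl : innerG (fun i x => g i x - h i x) k = innerG g k - innerG h k.
Proof.
by rewrite /innerG -sumrB; apply: eq_bigr => i _ /=; rewrite innerOBl.
Qed.

Lemma innerG_lin_le a b :
  innerG (fun i x => a * g i x + b * h i x) (fun i x =>
    a * g i x + b * h i x) <=
  2 * a ^+ 2 * innerG g g + 2 * b ^+ 2 * innerG h h.
Proof.
rewrite /innerG !mulr_sumr -big_split; apply: ler_sum => i _ /=.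
exact: innerO_lin_le.
Qed.

Lemma innerG_CS : innerG g h ^+ 2 <= innerG g g * innerG h h.
Proof.
apply: discriminant_le => t.
have := innerG_ge0 (fun i x => g i x + t * h i x).
rewrite /innerG !mulr_sumr -!big_split/= => H; apply: le_trans H _;
  apply: ler_sum => i _.
have hth := L2Z t (hh i); rewrite innerODl//; last exact: L2D.
rewrite !innerODr// innerOZl// !innerOZr// innerOZl// [innerO (h i) _]innerOC.
rewrite le_eqVlt; apply/orP; left; apply/eqP; ring.
Qed.

End innerG.

Lemma test_weak_gradient phi : test phi -> is_weak_gradient phi (grad phi).
Proof.
move=> tp i; split; first exact: (test_L2 OM (test_partial i tp)).
by move=> psi tq; exact: (test_by_parts OM i (test_smooth tp) tq).
Qed.

Lemma grad_L2 phi i : test phi -> L2 (grad phi i).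
Proof. by move=> tp; have [] := test_weak_gradient tp i. Qed.

Lemma weak_gradient_lin a b u v g h : L2 u -> L2 v -> is_weak_gradient u g ->
  is_weak_gradient v h ->
  is_weak_gradient (fun x => a * u x + b * v x) (fun i x =>
    a * g i x + b * h i x).
Proof.
move=> hu hv ug vh i; have [hg gE] := ug i; have [hh hE] := vh i.
split; first by apply: L2D; exact: L2Z.
move=> phi tp; have hp := test_L2 OM tp; have hdp := grad_L2 i tp.
rewrite -!/(innerO _ _) innerODl//; [|exact: L2Z..].
rewrite [in RHS]innerODl//; [|exact: L2Z..].
rewrite !innerOZl// /innerO gE// hE//; ring.
Qed.

Lemma weak_gradientB u v g h : L2 u -> L2 v -> is_weak_gradient u g ->
  is_weak_gradient v h ->
  is_weak_gradient (fun x => u x - v x) (fun i x => g i x - h i x).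
Proof.
move=> hu hv ug vh i; have [hg gE] := ug i; have [hh hE] := vh i.
split; first exact: L2B.
move=> phi tp; have hp := test_L2 OM tp; have hdp := grad_L2 i tp.
rewrite -!/(innerO _ _) innerOBl// [in RHS]innerOBl// /innerO gE// hE//; ring.
Qed.

(** [g] witnesses that [xget] returns a weak derivative; two of them have equal integrals against
    test functions, so the fundamental lemma identifies them a.e. *)
Lemma weak_partialE i u (g : 'rV[R]_n -> R) : weak_partial_of Omega i u g ->
  L2 (weak_partial Omega i u) /\ ae_eq leb Omega (weak_partial Omega i u) g.
Proof.
move=> ug; have [hw wE] : weak_partial_of Omega i u (weak_partial Omega i u).
  exact: (@xgetPex _ (cst 0) [set g' | weak_partial_of Omega i u g']
    (ex_intro _ g ug)).
split=> //; have [hg gE] := ug.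
have P phi : test phi ->
    innerO (fun x => weak_partial Omega i u x - g x) phi = 0.
  move=> tp; rewrite innerOBl//; last exact: (test_L2 OM tp).
  by apply/eqP; rewrite subr_eq0 /innerO -eqr_opp -wE// -gE.
have := fundamental_lemma oO OM (L2B hw hg) P;
  apply: filterS => x + Ox => /(_ Ox) /eqP.
by rewrite subr_eq0 => /eqP.
Qed.

Lemma grad_dotE u v g h : is_weak_gradient u g -> is_weak_gradient v h ->
  \int[leb]_(x in Omega) grad_dot Omega u v x = innerG g h.
Proof.
move=> ug vh; rewrite /grad_dot.
pose G i := weak_partial Omega i u; pose H i := weak_partial Omega i v.
have hG i : L2 (G i) := (weak_partialE (ug i)).1.
have hH i : L2 (H i) := (weak_partialE (vh i)).1.
transitivity (innerG G H); last first.
  apply: eq_bigr => i _; apply: eq_innerO => //.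
  - by have [] := ug i.
  - by have [] := vh i.
  - exact: (weak_partialE (ug i)).2.
  - exact: (weak_partialE (vh i)).2.
rewrite /innerG /Rintegral.
under eq_integral do rewrite -sumEFin.
rewrite integral_sum//; last by move=> i; exact: (innerO_integrable mO (hG i)
  (hH i)).
rewrite (eq_bigr (fun i => (innerO (G i) (H i))%:E)) ?sumEFin// => i _.
rewrite /innerO /Rintegral fineK//; apply: integrable_fin_num => //.
exact: (innerO_integrable mO (hG i) (hH i)).
Qed.

Lemma H1_normE u g : L2 u -> is_weak_gradient u g ->
  H1_norm Omega u = Num.sqrt (innerO u u + innerG g g).
Proof.
move=> hu ug; rewrite /H1_norm (grad_dotE ug ug); congr (Num.sqrt (_ + _)).
Qed.

(* [g] is a weak gradient of [u], and both are limits in [L^2] along one family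
   of test functions. *)
Definition H10_gradient u g := [/\ L2 u, is_weak_gradient u g & forall e : R,
  0 < e ->
  exists phi, [/\ test phi,
    innerO (fun x => u x - phi x) (fun x => u x - phi x) <= e &
    innerG (fun i x => g i x - grad phi i x) (fun i x =>
      g i x - grad phi i x) <= e]].

Lemma H10P u : H10 Omega u <-> exists g, H10_gradient u g.
Proof.
split=> [[[hu /choice[g ug]] happ]|[g [hu ug happ]]].
  exists g; split=> // e e0.
  have [|phi tp] := happ (Num.sqrt e); first by rewrite sqrtr_gt0.
  rewrite (H1_normE (L2B hu (test_L2 OM tp)) (weak_gradientB hu (test_L2 OM
    tp) ug (test_weak_gradient tp))).
  rewrite ltr_sqrt// => h; exists phi; split=> //.
    by apply: le_trans (ltW h); rewrite lerDl innerG_ge0.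
  by apply: le_trans (ltW h); rewrite lerDr innerO_ge0.
split; first by split=> // i; exists (g i); exact: ug.
(* A quarter of [e ^+ 2] for each of the two squared norms keeps their sum strictly below
   [e ^+ 2]. *)
move=> e e0; have [|phi [tp h1 h2]] := happ (e ^+ 2 / 4).
  by rewrite divr_gt0// exprn_gt0.
exists phi => //.
rewrite (H1_normE (L2B hu (test_L2 OM tp)) (weak_gradientB hu (test_L2 OM tp)
  ug (test_weak_gradient tp))).
rewrite -[ltRHS]ger0_norm ?(ltW e0)// -sqrtr_sqr ltr_sqrt ?exprn_gt0//.
have : 0 < e ^+ 2 by rewrite exprn_gt0.
lra.
Qed.

Lemma H10_gradient_lin a b u v g h : H10_gradient u g -> H10_gradient v h ->
  H10_gradient (fun x => a * u x + b * v x) (fun i x => a * g i x + b * h i x).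
Proof.
move=> [hu ug uapp] [hv vh vapp]; split; first by apply: L2D; exact: L2Z.
  exact: weak_gradient_lin.
(* [K] adds up the coefficients of the two errors in the parallelogram bound; the extra 1 keeps it
   positive when [a = b = 0]. *)
move=> e e0; pose K := 2 * a ^+ 2 + 2 * b ^+ 2 + 1.
have K0 : 0 < K by rewrite ltr_wpDl// addr_ge0// mulr_ge0// sqr_ge0.
have eK : 0 < e / K by rewrite divr_gt0.
have [phi [tp p1 p2]] := uapp _ eK; have [psi [tq q1 q2]] := vapp _ eK.
have bound X Y : X <= e / K -> Y <= e / K ->
    2 * a ^+ 2 * X + 2 * b ^+ 2 * Y <= e.
  move=> Xe Ye; have a2 : 0 <= 2 * a ^+ 2 by rewrite mulr_ge0 ?sqr_ge0.
  have b2 : 0 <= 2 * b ^+ 2 by rewrite mulr_ge0 ?sqr_ge0.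
  apply: (le_trans (lerD (ler_wpM2l a2 Xe) (ler_wpM2l b2 Ye))).
  by rewrite -mulrDl mulrA ler_pdivrMr// mulrC ler_wpM2l ?(ltW e0)// lerDl.
have tpq : test (fun x => a * phi x + b * psi x) by apply: testD; exact: testZ.
exists (fun x => a * phi x + b * psi x); split=> //.
  apply: le_trans (bound _ _ p1 q1).
  have := innerO_lin_le a b (L2B hu (test_L2 OM tp)) (L2B hv (test_L2 OM tq)).
  apply: le_trans; rewrite le_eqVlt; apply/orP; left; apply/eqP.
  by apply: eq_Rintegral => x _; congr (_ * _); ring.
apply: le_trans (bound _ _ p2 q2).
have hgp i : L2 (fun x => g i x - grad phi i x).
  by apply: L2B; [have [] := ug i|exact: grad_L2].
have hhq i : L2 (fun x => h i x - grad psi i x).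
  by apply: L2B; [have [] := vh i|exact: grad_L2].
apply: le_trans (innerG_lin_le hgp hhq a b).
rewrite le_eqVlt; apply/orP; left; apply/eqP; apply: eq_bigr => i _.
apply: eq_Rintegral => x _; rewrite /grad (partial_testD i (testZ a tp)
  (testZ b tq)).
by rewrite (partial_testZ i a tp) (partial_testZ i b tq); congr (_ * _); ring.
Qed.

Lemma H10_gradientZ a u g : H10_gradient u g ->
  H10_gradient (fun x => a * u x) (fun i x => a * g i x).
Proof.
move=> ug; have := H10_gradient_lin a 0 ug ug.
have -> : (fun x => a * u x + 0 * u x) = (fun x => a * u x).
  by apply/funext => x; rewrite mul0r addr0.
have -> : (fun i x => a * g i x + 0 * g i x) = (fun i x => a * g i x).
  by apply/funext => i; apply/funext => x; rewrite mul0r addr0.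
by [].
Qed.

Lemma H10_gradient_L2 u g i : H10_gradient u g -> L2 (g i).
Proof. by move=> [_ ug _]; have [] := ug i. Qed.

Hypothesis n0 : (0 < n)%N.

Let C : R := 4 * M ^+ 2.

Let C0 : 0 <= C. Proof. by rewrite mulr_ge0// sqr_ge0. Qed.

Lemma test_Poincare_innerG phi : test phi ->
  innerO phi phi <= C * innerG (grad phi) (grad phi).
Proof.
move=> tp; apply: le_trans (test_Poincare oO OM (Ordinal n0) tp) _.
by apply: ler_wpM2l => //; exact: (innerO_le_innerG (Ordinal n0) (grad phi)).
Qed.

Lemma H10_gradient_eq0 u g : H10_gradient u g -> innerG g g = 0 ->
  ae_eq leb Omega u (cst 0).
Proof.
move=> ug g0; have [hu wug happ] := ug; apply: innerO_eq0 => //.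
(* The approximant has squared gradient norm at most [2 e], hence squared norm at most [2 C e] by
   Poincare, so that of [u] is at most [(2 + 4 C) e]. The factor [innerO u u] gives the bound the
   shape of a square. *)
apply: (@eq0_of_sqr_le _ _ (innerO u u * (2 + 4 * C))) => e e0.
have [phi [tp p1 p2]] := happ e e0.
have hp := test_L2 OM tp; have hgp i := grad_L2 i tp;
  have hg i := H10_gradient_L2 i ug.
have P := test_Poincare_innerG tp.
have up : innerO u u <= 2 * innerO (fun x => u x - phi x) (fun x =>
  u x - phi x) + 2 * innerO phi phi.
  have := innerO_lin_le 1 1 (L2B hu hp) hp; rewrite !expr1n !mulr1.
  apply: le_trans; rewrite le_eqVlt; apply/orP; left; apply/eqP.
  by apply: eq_Rintegral => x _; congr (_ * _); ring.
have gp : innerG (grad phi) (grad phi) <=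
    2 * innerG (fun i x => g i x - grad phi i x) (fun i x =>
      g i x - grad phi i x) + 2 * innerG g g.
  have hgB i := L2B (hg i) (hgp i).
  have := innerG_lin_le hgB hg (-1) 1; rewrite sqrrN !expr1n !mulr1.
  apply: le_trans; rewrite le_eqVlt; apply/orP; left; apply/eqP.
  by apply: eq_bigr => i _; apply: eq_Rintegral => x _; congr (_ * _); ring.
have : innerO u u <= e * (2 + 4 * C).
  rewrite g0 mulr0 addr0 in gp.
  have : C * innerG (grad phi) (grad phi) <= C * (2 * e) by rewrite
    ler_wpM2l//; lra.
  lra.
by move=> h; rewrite expr2 mulrCA; apply: ler_wpM2l => //; exact: innerO_ge0.
Qed.

End weak_gradient.

(** * The Poisson problem by Dirichlet's principle *)

Section Poisson.
Context (R : realType) (n : nat) (Omega : set 'rV[R]_n).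
Hypothesis oO : open Omega.
Variable M : R.
Hypothesis OM : forall x, Omega x -> `|x| <= M.
Hypothesis n0 : (0 < n)%N.
Local Notation leb := (lebesgue_rV n).
Local Notation L2 := (L2 Omega).
Local Notation innerO := (innerO Omega).
Local Notation innerG := (innerG Omega).
Local Notation test := (test_function Omega).
Variable f : 'rV[R]_n -> R.
Hypothesis hf : L2 f.
Implicit Types (phi psi : 'rV[R]_n -> R).

Let mO : measurable Omega. Proof. exact: open_measurable_rV. Qed.

Let C : R := 4 * M ^+ 2.

Let C0 : 0 <= C. Proof. by rewrite mulr_ge0// sqr_ge0. Qed.

Let Dg phi psi := innerG (grad phi) (grad psi).

(** Twice the usual Dirichlet energy of [- Delta w = f]. *)
Let J phi := Dg phi phi - 2 * innerO f phi.

Let J_lin a b phi psi : test phi -> test psi ->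
  J (fun x => a * phi x + b * psi x) =
  a ^+ 2 * Dg phi phi + 2 * a * b * Dg phi psi + b ^+ 2 * Dg psi psi
  - 2 * (a * innerO f phi + b * innerO f psi).
Proof.
move=> tp tq; have hp i := grad_L2 OM i tp; have hq i := grad_L2 OM i tq.
have E : grad (fun x => a * phi x + b * psi x) =
    fun i x => a * grad phi i x + b * grad psi i x.
  apply/funext => i; rewrite /grad (partial_testD i (testZ a tp) (testZ b tq)).
  by rewrite (partial_testZ i a tp) (partial_testZ i b tq).
have hpq i : L2 (fun x => a * grad phi i x + b * grad psi i x).
  by apply: L2D; exact: L2Z.
have L2p := test_L2 OM tp; have L2q := test_L2 OM tq.
rewrite /J /Dg E innerG_linl// !(innerGC _ _ (fun i x =>
  a * grad phi i x + b * grad psi i x)).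
rewrite !innerG_linl// (innerGC _ (grad psi) (grad phi)).
rewrite innerODr//; [|exact: L2Z..].
have -> : innerO f (fun x => a * phi x) = a * innerO f phi by exact: innerOZr.
have -> : innerO f (fun x => b * psi x) = b * innerO f psi by exact: innerOZr.
move: (innerG _ _) (innerG _ _) (innerG _ _) (innerO _ _) (innerO _ _) =>
  A B E' F G; ring.
Qed.

Let test0 : test (cst 0).
Proof.
apply: (@test_functionI _ _ _ _ set0) => //; first exact: smooth_cst.
  exact: compact0.
by move=> x; rewrite eqxx.
Qed.

(** With [K = C |f|^2], [l = <f, phi>] and [D = Dg phi phi], Cauchy-Schwarz and Poincare give
    [l^2 <= K D]. A value [D - 2 l < - K] would then give [(D + K)^2 < 4 K D], contrary to
    [(D - K)^2 >= 0]. *)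
Let J_ge phi : test phi -> - (innerO f f * C) <= J phi.
Proof.
move=> tp; have P := test_Poincare_innerG oO OM n0 tp.
have CS := innerO_CS hf (test_L2 OM tp); have F0 := innerO_ge0 Omega f.
have D0 : 0 <= Dg phi phi by exact: innerG_ge0.
have : innerO f phi ^+ 2 <= innerO f f * C * Dg phi phi.
  by apply: (le_trans CS); rewrite -mulrA ler_wpM2l.
have : 0 <= innerO f f * C by rewrite mulr_ge0.
rewrite /J; move: (innerO f f * C) (Dg phi phi) (innerO f phi) D0 =>
  K D l D0 K0 lKD.
rewrite -subr_ge0; have [//|neg] := leP 0 (D - 2 * l - - K).
have h : D + K < 2 * l by lra.
have : (D + K) ^+ 2 < (2 * l) ^+ 2 by rewrite ltr_pXn2r// nnegrE; lra.
have := sqr_ge0 (D - K); nra.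
Qed.

Let S := [set J phi | phi in [set phi | test phi]].
Let m := inf S.

Let has_inf_S : has_inf S.
Proof.
split; first by exists (J (cst 0)), (cst 0).
by exists (- (innerO f f * C)) => _ [phi tp <-]; exact: J_ge.
Qed.

Let m_le phi : test phi -> m <= J phi.
Proof. by move=> tp; apply: ge_inf; [exact: has_inf_S.2|exists phi]. Qed.

(** An approximate Euler-Lagrange equation: [m <= J (phi + t v)] makes
    [e + 2 t (Dg phi v - <f, v>) + t^2 Dg v v] nonnegative for all [t], and the discriminant bounds
    the residual. *)
Let near_minimizer_grad phi e v : test phi -> J phi <= m + e -> test v ->
  (Dg phi v - innerO f v) ^+ 2 <= e * Dg v v.
Proof.
move=> tp Je tv; apply: discriminant_le => t.
have := m_le (testD (testZ 1 tp) (testZ t tv)).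
rewrite (J_lin _ _ tp tv); move: Je; rewrite /J.
by move: (Dg _ _) (Dg _ _) (Dg _ _) (innerO _ _) (innerO _ _) => A B E F G; lra.
Qed.

(** At the midpoint, [J] is the average of its two values less a quarter of the squared distance of
    the gradients; since it is still at least [m], that squared distance is at most [4 e]. *)
Let near_minimizers_close phi psi e : test phi -> test psi ->
  J phi <= m + e -> J psi <= m + e ->
  innerG (fun i x => grad phi i x - grad psi i x) (fun i x =>
    grad phi i x - grad psi i x)
  <= 4 * e.
Proof.
move=> tp tq Jp Jq; have hp i := grad_L2 OM i tp; have hq i := grad_L2 OM i tq.
have hpq i := L2B (hp i) (hq i).
rewrite innerGBl// !(innerGC _ _ (fun i x =>
  grad phi i x - grad psi i x)) !innerGBl//.
rewrite (innerGC _ (grad psi) (grad phi)) -/(Dg phi phi) -/(Dg phi psi) -/(Dg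
  psi psi).
have := m_le (testD (testZ 2^-1 tp) (testZ 2^-1 tq)).
rewrite (J_lin _ _ tp tq); move: Jp Jq; rewrite /J.
move: (Dg _ _) (Dg _ _) (Dg _ _) (innerO _ _) (innerO _ _) => A B E F G Jp Jq.
have -> : 2 * 2^-1 * 2^-1 = 2^-1 :> R by field.
have -> : 2^-1 ^+ 2 = 4^-1 :> R by field.
lra.
Qed.

Lemma weak_poisson : exists w g, H10_gradient Omega w g /\
  forall v h, H10_gradient Omega v h -> innerG g h = innerO f v.
Proof.
pose eps k : R := k.+1%:R^-1.
have eps0 k : 0 < eps k by rewrite invr_gt0.
have eps_small (e : R) : 0 < e -> exists N, forall k, (N <= k)%N -> eps k <= e.
  move=> e0; exists (Num.trunc e^-1).+1 => k Nk.
  rewrite /eps -[leRHS]invrK lef_pV2 ?posrE ?invr_gt0//.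
  rewrite (le_trans (ltW (truncnS_gt _)))// ler_nat.
  exact: leq_trans Nk _.
have /choice[phi hphi] k : exists phi, test phi /\ J phi <= m + eps k.
  have [_ [phi tp <-] Jp] := inf_adherent (eps0 k) has_inf_S.
  by exists phi; split=> //; exact: ltW.
have tphi k : test (phi k) := (hphi k).1.
have hgphi k i := grad_L2 OM i (tphi k).
have Cauchy (e : R) : 0 < e -> exists N, forall i j, (N <= i)%N -> (N <= j)%N ->
    innerG (fun l x => grad (phi i) l x - grad (phi j) l x)
        (fun l x => grad (phi i) l x - grad (phi j) l x) <= e.
  move=> e0; have [|N hN] := eps_small (e / 4); first by rewrite divr_gt0.
  exists N => i j Ni Nj.
  have le_e k : (N <= k)%N -> J (phi k) <= m + e / 4.
    by move=> Nk; apply: (le_trans (hphi k).2); rewrite lerD2l hN.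
  have := near_minimizers_close (tphi i) (tphi j) (le_e i Ni) (le_e j Nj).
  by move=> H; apply: (le_trans H); lra.
have [k|e e0|w hw wcv] := @L2_complete_on _ _ Omega mO phi.
- exact: (test_L2 OM (tphi k)).
(* [C] may be 0, so the tolerance is divided by [C + 1]. *)
- have C1 : 0 < C + 1 by rewrite ltr_wpDl.
  have [|N hN] := Cauchy (e / (C + 1)); first by rewrite divr_gt0.
  exists N => i j Ni Nj; have tij := testB (tphi i) (tphi j).
  apply: (le_trans (test_Poincare_innerG oO OM n0 tij)).
  have -> : grad (fun x => phi i x - phi j x) =
      fun l x => grad (phi i) l x - grad (phi j) l x.
    by apply/funext => l; exact: (partial_testB l (tphi i) (tphi j)).
  apply: (@le_trans _ _ (C * (e / (C + 1)))).
    by apply: ler_wpM2l => //; exact: hN.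
  rewrite mulrA ler_pdivrMr// -/C; nra.
have /choice[g hg] l : exists gl, L2 gl /\ forall e : R, 0 < e ->
  exists N, forall i, (N <= i)%N ->
    innerO (fun x => gl x - grad (phi i) l x) (fun x =>
      gl x - grad (phi i) l x) <= e.
  have [k|e e0|gl h1 h2] := @L2_complete_on _ _ Omega mO (fun k =>
    grad (phi k) l).
  - exact: hgphi.
  - have [N hN] := Cauchy e e0; exists N => i j Ni Nj.
    by apply: le_trans (hN i j Ni Nj); exact: (innerO_le_innerG Omega l
      (fun l x => grad (phi i) l x - grad (phi j) l x)).
  by exists gl.
have L2g l : L2 (g l) := (hg l).1.
have key (e : R) : 0 < e -> exists k, [/\ eps k <= e,
    innerO (fun x => w x - phi k x) (fun x => w x - phi k x) <= e &
    innerG (fun l x => g l x - grad (phi k) l x) (fun l x =>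
      g l x - grad (phi k) l x) <= e].
  move=> e0; have [N1 h1] := eps_small e e0; have [N2 h2] := wcv e e0.
  have en : 0 < e / n%:R by rewrite divr_gt0// ltr0n.
  have /choice[N3 h3] l := (hg l).2 (e / n%:R) en.
  (* The sum of the thresholds dominates each of them, and the [n] gradient components share the
     tolerance [e]. *)
  pose k := (N1 + N2 + \sum_l N3 l)%N; exists k; split.
  - by apply: h1; rewrite /k -addnA leq_addr.
  - by apply: h2; rewrite /k addnAC leq_addl.
  apply: (@le_trans _ _ (\sum_(l < n) e / n%:R)).
    apply: ler_sum => l _; apply: h3.
    by rewrite /k (bigD1 l)//= addnCA leq_addr.
  by rewrite sumr_const card_ord -[leLHS]mulr_natr divfK// pnatr_eq0 -lt0n.
have sq2 (x y : R) : (x + y) ^+ 2 <= 2 * x ^+ 2 + 2 * y ^+ 2.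
  by have := sqr_ge0 (x - y); lra.
(* So far [w] and the [g l] are separate limits; integration by parts for [phi k] passes to the
   limit and relates them. *)
have wg : is_weak_gradient Omega w g.
  move=> i; split; first exact: L2g.
  move=> psi tq; have hq := test_L2 OM tq; have hdq := grad_L2 OM i tq.
  apply/eqP; rewrite -addr_eq0; apply/eqP.
  apply: (@eq0_of_sqr_le _ _ (2 * innerO (grad psi i) (grad psi i) + 2 *
    innerO psi psi)) => e e0.
  have [k [_ h1 h2]] := key e e0; have hp := test_L2 OM (tphi k).
  have := sq2 (innerO (fun x => w x - phi k x) (grad psi i))
              (innerO (fun x => g i x - grad (phi k) i x) psi).
  have CS1 := innerO_CS (L2B hw hp) hdq.
  have CS2 := innerO_CS (L2B (L2g i) (hgphi k i)) hq.
  rewrite {1}innerOBl// {1}(innerOBl _ (L2g i))// -/(innerO _ _) -/(innerO _ _).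
  rewrite [innerO (phi k) _](test_by_parts OM i (test_smooth (tphi k)) tq)
    opprK.
  rewrite addrACA addrN addr0 => H; apply: (le_trans H).
  have q1 := innerO_ge0 Omega (grad psi i); have q2 := innerO_ge0 Omega psi.
  have le2 := le_trans (innerO_le_innerG Omega i (fun l x =>
    g l x - grad (phi k) l x)) h2.
  have : innerO (fun x => w x - phi k x) (fun x =>
    w x - phi k x) * innerO (grad psi i) (grad psi i)
    <= e * innerO (grad psi i) (grad psi i) by rewrite ler_wpM2r.
  have : innerO (fun x => g i x - grad (phi k) i x) (fun x =>
    g i x - grad (phi k) i x) * innerO psi psi
    <= e * innerO psi psi by rewrite ler_wpM2r.
  lra.
have weq v : test v -> innerG g (grad v) = innerO f v.
  move=> tv; have hgv i := grad_L2 OM i tv; apply/eqP; rewrite -subr_eq0;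
    apply/eqP.
  (* Half of the constant pays for the distance from [g] to [grad (phi k)], half for the approximate
     Euler-Lagrange equation of [phi k]. *)
  apply: (@eq0_of_sqr_le _ _ (4 * Dg v v)) => e e0.
  have [k [h0 _ h2]] := key e e0.
  have := sq2 (innerG (fun l x => g l x - grad (phi k) l x) (grad v)) (Dg
    (phi k) v - innerO f v).
  have CS := innerG_CS oO (fun l => L2B (L2g l) (hgphi k l)) hgv.
  have near := near_minimizer_grad (tphi k) (hphi k).2 tv.
  rewrite {1}innerGBl// addrA subrK => H; apply: (le_trans H).
  have D0 : 0 <= Dg v v by exact: innerG_ge0.
  have -> : e * (4 * Dg v v) = 2 * (e * Dg v v) + 2 * (e * Dg v v) by ring.
  apply: lerD; rewrite ler_pM2l//.
    exact: le_trans CS (ler_wpM2r D0 h2).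
  exact: le_trans near (ler_wpM2r D0 h0).
exists w, g; split.
  split=> // e e0; have [k [_ h1 h2]] := key e e0.
  by exists (phi k); split.
move=> v h vh; have [hv _ happ] := vh; have hh i := H10_gradient_L2 i vh.
apply/eqP; rewrite -subr_eq0; apply/eqP.
(* The equation for the test function [psi] cancels, leaving the errors [h - grad psi] and
   [v - psi]. *)
apply: (@eq0_of_sqr_le _ _ (2 * innerG g g + 2 * innerO f f)) => e e0.
have [psi [tq q1 q2]] := happ e e0.
have hq := test_L2 OM tq; have hgq i := grad_L2 OM i tq.
have hhq i := L2B (hh i) (hgq i).
have := sq2 (innerG g (fun i x => h i x - grad psi i x)) (- innerO f (fun x
  => v x - psi x)).
have CS1 := innerG_CS oO L2g hhq; have CS2 := innerO_CS hf (L2B hv hq).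
rewrite {1}innerGC innerGBl// ![innerG _ g]innerGC (weq _ tq) {1}innerOBr//.
rewrite opprB addrA subrK sqrrN => H; apply: (le_trans H).
have := ler_wpM2l (innerG_ge0 Omega g) q2;
  have := ler_wpM2l (innerO_ge0 Omega f) q1.
lra.
Qed.

End Poisson.

(** * The cubic equation *)

Section cubic.
Context (R : realType).
Implicit Types (t c mu : R).

Definition has_roots (k : nat) (p : R -> R) c :=
  exists s : 'I_k -> R, [/\ injective s, forall i, p (s i) = c &
    forall t, p t = c -> exists i, t = s i].

(** Normal form of the cubic: an odd function with local maximum 2 at 1, a value taken again at
    -2. *)
Let q t := 3 * t - t ^+ 3.

Lemma normal_cubic_ivt t0 t1 c : t0 <= t1 ->
  q t0 <= c <= q t1 \/ q t1 <= c <= q t0 ->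
  exists2 t, t0 <= t <= t1 & q t = c.
Proof.
move=> t01 qc.
have [||t tt qt] := @IVT R q t0 t1 c t01.
- apply: continuous_subspaceT => t.
  apply: continuousB; first by apply: continuousM;
    [exact: cst_continuous|exact: cvg_id].
  exact: exprn_continuous.
- by rewrite ge_min le_max; case: qc => /andP[-> ->]; rewrite ?orbT.
by exists t => //; move: tt; rewrite in_itv.
Qed.

(** Divide [q t0 = q t1] by [t0 - t1]. Two such relations sharing a root show that three distinct
    roots have sum 0. *)
Lemma normal_cubic_distinct_roots t0 t1 c : q t0 = c -> q t1 = c -> t0 != t1 ->
  t0 ^+ 2 + t0 * t1 + t1 ^+ 2 = 3.
Proof.
move=> h0 h1 h; have : (t0 - t1) * (t0 ^+ 2 + t0 * t1 + t1 ^+ 2 - 3) = 0.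
  by move: h0 h1; rewrite /q => h0 h1; lra.
by move/eqP; rewrite mulf_eq0 subr_eq0 (negbTE h) /= subr_eq0 => /eqP.
Qed.

Lemma normal_cubic_roots3 c : 0 < c < 2 -> has_roots 3 q c.
Proof.
move=> /andP[c0 c2].
have [||t1 /andP[a1 b1] q1] := @normal_cubic_ivt (-2) (-1) c; [lra|by right;
  rewrite /q; lra|].
have [||t2 /andP[a2 b2] q2] := @normal_cubic_ivt 0 1 c; [lra|by left;
  rewrite /q; lra|].
have [||t3 /andP[a3 b3] q3] := @normal_cubic_ivt 1 2 c; [lra|by right;
  rewrite /q; lra|].
(* The brackets [[0, 1]] and [[1, 2]] meet at 1, where [q] is 2 and not [c]. *)
have n23 : t2 != t3.
  apply/eqP => E; have e1 : t2 = 1 by lra.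
  by move: q2; rewrite /q e1; lra.
have n12 : t1 != t2 by apply/eqP; lra.
have n13 : t1 != t3 by apply/eqP; lra.
have third t t' t'' : q t = c -> q t' = c -> q t'' = c -> t != t' -> t != t'' ->
    t' != t'' -> t'' = - t - t'.
  move=> h1 h2 h3 h12 h13 h23.
  have e1 := normal_cubic_distinct_roots h1 h2 h12;
    have e2 := normal_cubic_distinct_roots h1 h3 h13.
  have : (t' - t'') * (t + t' + t'') = 0 by lra.
  by move/eqP; rewrite mulf_eq0 subr_eq0 (negbTE h23)/= => /eqP; lra.
exists (fun i : 'I_3 => [:: t1; t2; t3]`_i); split.
- move=> [[|[|[|i]]] hi] [[|[|[|j]]] hj] //= E; apply: val_inj => //=;
    by move: n12 n13 n23; rewrite E ?eqxx.
- by move=> [[|[|[|i]]] hi].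
move=> t qt.
have [->|h1] := eqVneq t1 t; first by exists ord0.
have [->|h2] := eqVneq t2 t; first by exists (@Ordinal 3 1 isT).
exists (@Ordinal 3 2 isT) => /=.
by rewrite (third t1 t2 t)// (third t1 t2 t3).
Qed.

Lemma normal_cubic_roots2 : has_roots 2 q 2.
Proof.
exists (fun i : 'I_2 => [:: 1; -2]`_i); split.
- by move=> [[|[|i]] hi] [[|[|j]] hj] //= E; try exact: val_inj; exfalso; lra.
- by move=> [[|[|i]] hi] //=; rewrite /q; ring.
move=> t qt; have : (t - 1) ^+ 2 * (t + 2) = 0 by move: qt; rewrite /q => qt;
  lra.
move/eqP; rewrite mulf_eq0 sqrf_eq0 subr_eq0 addr_eq0 => /orP[]/eqP ->.
  by exists ord0.
by exists (@Ordinal 2 1 isT).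
Qed.

Lemma normal_cubic_roots1 c : 2 < c -> has_roots 1 q c.
Proof.
move=> c2.
have [||r /andP[a1 b1] qr] := @normal_cubic_ivt (- (c + 2)) (-2) c;
  first by lra.
  by right; rewrite /q; apply/andP; split; nra.
have r2 : r < -2.
  rewrite lt_neqAle b1 andbT; apply/eqP => r2.
  by move: qr; rewrite /q r2; lra.
exists (fun=> r); split=> [i j _|//|t qt]; first by rewrite (ord1 i) (ord1 j).
exists ord0; apply/eqP/negPn/negP => tr.
(* Four times this relation reads [(2 t + r)^2 + 3 r^2 = 12], impossible for [r < -2]. *)
have := normal_cubic_distinct_roots qt qr tr; have := sqr_ge0 (2 * t + r); nra.
Qed.

Lemma has_roots_opp k p c : (forall t, p (- t) = - p t) ->
  has_roots k p c -> has_roots k p (- c).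
Proof.
move=> pN [s [sinj sc sall]]; exists (fun i => - s i); split.
- by move=> i j /oppr_inj/sinj.
- by move=> i; rewrite pN sc.
move=> t pt; have [|i ti] := sall (- t); first by rewrite pN pt opprK.
by exists i; rewrite -ti opprK.
Qed.

(** With [s0] the positive critical point and [m = p s0] the local maximum, the substitution
    [s = s0 t] turns [p] into [m / 2 * q]; oddness reduces the count to [mu >= 0]. *)
Lemma cubic_roots (a k : R) : 0 < a -> 0 < k -> exists m : R, 0 < m /\
  forall mu, let p := fun s : R => s * (a - k * s ^+ 2) in
  [/\ 0 < `|mu| < m -> has_roots 3 p mu,
      (mu = m \/ mu = - m) -> has_roots 2 p mu &
      m < `|mu| -> has_roots 1 p mu].
Proof.
move=> a0 k0; pose s0 := Num.sqrt (a / (3 * k)); pose m := 2 / 3 * a * s0.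
have ak : 0 < a / (3 * k) by rewrite divr_gt0// mulr_gt0.
have s00 : 0 < s0 by rewrite sqrtr_gt0.
have s02 : k * s0 ^+ 2 = a / 3.
  by rewrite sqr_sqrtr ?(ltW ak)//; field; rewrite gt_eqF.
have m0 : 0 < m by rewrite !mulr_gt0.
exists m; split=> // mu p.
have pE t : p (s0 * t) = m / 2 * q t.
  by rewrite /p exprMn mulrA s02 /m /q; field.
have pN t : p (- t) = - p t by rewrite /p sqrrN mulNr.
have scale j nu : has_roots j q (2 * nu / m) -> has_roots j p nu.
  move=> [s [sinj sc sall]]; exists (fun i => s0 * s i); split.
  - by move=> i j' /(mulfI (lt0r_neq0 s00))/sinj.
  - by move=> i; rewrite pE sc; field; rewrite gt_eqF.
  move=> t pt; have [|i ti] := sall (t / s0).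
    have : p (s0 * (t / s0)) = nu by rewrite mulrC divfK// gt_eqF.
    by rewrite pE => <-; field; rewrite gt_eqF.
  by exists i; rewrite -ti mulrC divfK// gt_eqF.
have sgn j : has_roots j p `|mu| -> has_roots j p mu.
  have [mu0|mu0] := leP 0 mu; first by rewrite ger0_norm.
  by rewrite ltr0_norm// => /(has_roots_opp pN); rewrite opprK.
split.
- move=> /andP[mu0 mum]; apply/sgn/scale/normal_cubic_roots3; apply/andP; split.
    by rewrite divr_gt0// mulr_gt0.
  by rewrite ltr_pdivrMr// ltr_pM2l.
- move=> mum; apply/sgn/scale.
  have -> : `|mu| = m by case: mum => ->; rewrite ?normrN gtr0_norm.
  have -> : 2 * m / m = 2 by field; rewrite gt_eqF.
  exact: normal_cubic_roots2.
- by move=> mum; apply/sgn/scale/normal_cubic_roots1;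
    rewrite ltr_pdivlMr// ltr_pM2l.
Qed.

End cubic.

(** * Nonempty open sets have positive measure *)

Section open_measure.
Context (R : realType) (n : nat).

(** The set contains a ball, which is a box of volume [(2 e)^n]. Hence [Omega] is not negligible,
    and a function positive a.e. on it is not a.e. zero. *)
Lemma lebesgue_rV_open_gt0 (U : set 'rV[R]_n) : open U -> U !=set0 ->
  (0 < lebesgue_rV n U)%E.
Proof.
move=> oU [x Ux]; have /nbhs_ballP[e /= e0 eU] : nbhs x U by exact:
  open_nbhs_nbhs.
apply: (@lt_le_trans _ _ (lebesgue_rV n (ball x e))); last first.
  by apply: le_measure; rewrite ?inE//; [exact: measurable_ball_rV|exact:
    open_measurable_rV].
have -> : ball x e = [set y | forall i, (fun i =>
  ball (x ord0 i) e) i (y ord0 i)].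
  apply/seteqP; split=> y; first by move/(ball_rVP _ _ e0) => h i; exact: h.
  by move=> h; apply/(ball_rVP _ _ e0) => i; exact: h.
rewrite (@lebesgue_rV_box R n (fun i => ball (x ord0 i) e))//; last first.
  by move=> i; exact: measurable_ball.
rewrite (eq_bigr (fun=> (e *+ 2)%:E)); last first.
  by move=> i _; rewrite lebesgue_measure_ball ?ltW.
by rewrite prodEFin lte_fin prodr_gt0// => i _; rewrite mulrn_wgt0.
Qed.

End open_measure.

(** * Solutions of the nonlocal problem *)

Section scaled_solutions.
Context (R : realType) (n : nat) (Omega : set 'rV[R]_n).
Hypothesis oO : open Omega.
Hypothesis O0 : Omega !=set0.
Variable M : R.
Hypothesis OM : forall x, Omega x -> `|x| <= M.
Hypothesis n0 : (0 < n)%N.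
Local Notation leb := (lebesgue_rV n).
Local Notation L2 := (L2 Omega).
Local Notation innerO := (innerO Omega).
Local Notation innerG := (innerG Omega).
Local Notation test := (test_function Omega).
Variable f : 'rV[R]_n -> R.
Hypothesis hf : L2 f.
Hypothesis fpos : \forall x \ae leb, Omega x -> 0 < f x.

Let mO : measurable Omega. Proof. exact: open_measurable_rV. Qed.

Variables (w : 'rV[R]_n -> R) (g : 'I_n -> 'rV[R]_n -> R).
Hypothesis wg : H10_gradient Omega w g.
Hypothesis wE : forall v h, H10_gradient Omega v h -> innerG g h = innerO f v.

Let hg i : L2 (g i) := H10_gradient_L2 i wg.

Lemma test_H10_gradient phi : test phi -> H10_gradient Omega phi (grad phi).
Proof.
move=> tp; have z (u : 'rV[R]_n -> R) : innerO (fun x => u x - u x) (fun x =>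
  u x - u x) = 0.
  rewrite /innerO /Rintegral integral0_eq// => x _.
  by rewrite subrr mulr0.
split; [exact: (test_L2 OM tp)|exact: (test_weak_gradient OM tp)|move=> e e0].
exists phi; split=> //; first by rewrite z ltW.
by rewrite /innerG big1 ?ltW// => i _; exact: z.
Qed.

Lemma source_not_ae0 : ~ ae_eq leb Omega f (cst 0).
Proof.
move=> f0; have : leb.-negligible Omega.
  have [A [mA A0 sA]] : \forall x \ae leb, ~ Omega x.
    by apply: filterS2 fpos f0 => x fx f0x Ox; have := fx Ox;
      rewrite f0x// ltxx.
  by exists A; split=> // x Ox; apply: sA => /=; apply.
move/(measure_negligible mO) => O0'.
by have := lebesgue_rV_open_gt0 oO O0; rewrite O0' ltxx.
Qed.

Lemma innerG_gt0 : 0 < innerG g g.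
Proof.
rewrite lt_neqAle innerG_ge0 andbT eq_sym; apply/eqP => g0;
  apply: source_not_ae0.
apply: (fundamental_lemma oO OM hf) => phi tp.
rewrite -(wE (test_H10_gradient tp)); apply/eqP;
  rewrite -sqrf_eq0 eq_le sqr_ge0 andbT.
have := innerG_CS oO hg (fun i => grad_L2 OM i tp).
by rewrite g0 mul0r.
Qed.

Let D := innerG g g.

(** If [s] and [t] differed, [w] would vanish a.e., and [innerG g g = innerO f w] would be 0. *)
Lemma scaled_inj s t : ae_eq leb Omega (fun x => s * w x) (fun x =>
  t * w x) -> s = t.
Proof.
move=> st; apply/eqP/negPn/negP => nst.
have w0 : ae_eq leb Omega w (fun x => 0 * w x).
  apply: filterS st => x sx Ox; have /eqP := sx Ox.
  rewrite mul0r -subr_eq0 -mulrBl mulf_eq0 subr_eq0 (negbTE nst)/=.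
  by move/eqP.
have hw : L2 w by case: wg.
have := innerG_gt0; rewrite (wE wg) (eq_innerO mO hf hf hw (L2Z 0 hw) _
  w0)//; last exact: ae_eq_refl.
have -> : innerO f (fun x => 0 * w x) = 0 * innerO f w by exact: innerOZr.
by rewrite mul0r ltxx.
Qed.

Lemma weak_solution_scaled a b mu s : s * (a - b * D * s ^+ 2) = mu ->
  weak_solution Omega a b f mu (fun x => s * w x).
Proof.
move=> sE; have sw := H10_gradientZ oO OM s wg; have hsg i := L2Z s (hg i).
split; first by apply/(H10P oO OM); eexists; exact: sw.
move=> v /(H10P oO OM)[h vh]; have [_ ws _] := sw; have [_ wv _] := vh.
rewrite (grad_dotE oO OM ws ws) (grad_dotE oO OM ws wv) -/(innerO f v) -(wE vh).
have hh i := H10_gradient_L2 i vh.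
have gZ k : (forall i, L2 (k i)) -> innerG (fun i x =>
  s * g i x) k = s * innerG g k.
  move=> hk; rewrite /innerG mulr_sumr; apply: eq_bigr => i _.
  exact: innerOZl.
rewrite !gZ// (innerGC _ g (fun i x => s * g i x)) gZ// -/D -sE; ring.
Qed.

(** With [c] the nonlocal coefficient, [c u - mu w] lies in H_0^1 and its gradient is orthogonal to
    every H_0^1 gradient, in particular to itself, so it vanishes a.e. *)
Lemma weak_solution_is_scaled a b mu u : mu != 0 ->
  weak_solution Omega a b f mu u ->
  exists s, s * (a - b * D * s ^+ 2) = mu /\ ae_eq leb Omega u (fun x =>
    s * w x).
Proof.
move=> mu0 [/(H10P oO OM)[gu ug] uE]; have hgu i := H10_gradient_L2 i ug.
have [_ wu _] := ug.
pose c := a - b * innerG gu gu.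
have cE v h : H10_gradient Omega v h -> c * innerG gu h = mu * innerG g h.
  move=> vh; have [_ wv _] := vh.
  have Hv : H10 Omega v by apply/(H10P oO OM); exists h.
  have := uE v Hv; rewrite (grad_dotE oO OM wu wu) (grad_dotE oO OM wu wv).
  by rewrite -/(innerO f v) (wE vh).
have D0 : 0 < D := innerG_gt0.
(* The function tested is [w] itself: the right side becomes [mu * D]. *)
have c0 : c != 0.
  apply/eqP => c0; have := cE w g wg; rewrite c0 mul0r => /esym/eqP.
  by rewrite mulf_eq0 (negbTE mu0)/= gt_eqF.
have zH := H10_gradient_lin oO OM c (- mu) ug wg.
have [hu _ _] := ug; have [hw _ _] := wg.
have zz : innerG (fun i x => c * gu i x + - mu * g i x) (fun i x =>
  c * gu i x + - mu * g i x) = 0.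
  have hz i : L2 (fun x => c * gu i x + - mu * g i x) by apply: L2D; exact: L2Z.
  by rewrite innerG_linl// (cE _ _ zH) mulNr subrr.
have z0 := H10_gradient_eq0 oO OM n0 zH zz.
exists (mu / c); split.
  have e1 := cE u gu ug; have e2 := cE w g wg; rewrite (innerGC _ g gu) in e1.
  (* Testing with [u] and with [w] gives the squared gradient norm of [u] as [s^2 D] for
     [s = mu / c], which turns [c] into [a - b D s^2]. *)
  have gg : innerG gu gu = (mu / c) ^+ 2 * D.
    have xE : innerG gu g = mu * D / c.
      by apply: (mulfI c0); rewrite e2 [RHS]mulrC divfK.
    have -> : innerG gu gu = mu * innerG gu g / c.
      by apply: (mulfI c0); rewrite e1 [RHS]mulrC divfK.
    by rewrite xE; field.
  have -> : a - b * D * (mu / c) ^+ 2 = c.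
    by rewrite -(mulrA b) (mulrC D) -gg.
  by rewrite divfK.
apply: filterS z0 => x + Ox => /(_ Ox) /eqP.
rewrite mulNr subr_eq0 => /eqP h.
by apply/eqP; rewrite -(inj_eq (mulfI c0)) h mulrA mulrCA divff// mulr1.
Qed.

Lemma has_exactly_weak_solution k a b mu : mu != 0 ->
  has_roots k (fun s => s * (a - b * D * s ^+ 2)) mu ->
  has_exactly Omega k (weak_solution Omega a b f mu).
Proof.
move=> mu0 [s [sinj sc sall]]; exists (fun i x => s i * w x); split.
- by move=> i; apply: weak_solution_scaled; exact: sc.
- by move=> i j /scaled_inj/sinj.
- move=> u /(weak_solution_is_scaled mu0)[t [tc ut]].
  by have [i ti] := sall t tc; exists i; rewrite -ti.
Qed.

End scaled_solutions.

Unset Implicit Arguments.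

Theorem corollary1p3 (R : realType) (N : nat) (hN : (1 <= N)%N)
    (Omega : set 'rV[R]_N) (hOmega : bounded_domain Omega)
    (hbd : smooth_boundary Omega)
    (a b : R) (ha : 0 < a) (hb : 0 < b)
    (f : 'rV[R]_N -> R) (hf : L2 Omega f)
    (hfpos : \forall x \ae lebesgue_rV N, Omega x -> 0 < f x) :
  exists mu_ss : R, 0 < mu_ss /\
    forall mu : R,
      [/\ 0 < `|mu| < mu_ss ->
            has_exactly Omega 3 (weak_solution Omega a b f mu),
          (mu = mu_ss \/ mu = - mu_ss) ->
            has_exactly Omega 2 (weak_solution Omega a b f mu) &
          mu_ss < `|mu| ->
            has_exactly Omega 1 (weak_solution Omega a b f mu)].
Proof.
have [ne0 oO _ [M0 [_ bO]]] := hOmega.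
(* [bounded_set] yields a bound by every number above [M0]; [M0 + 1] is one. *)
have OM (x : 'rV[R]_N) : Omega x -> `|x| <= M0 + 1.
  by apply: bO; rewrite ltrDl.
have [w [g [wg wE]]] := weak_poisson oO OM hN hf.
have D0 := innerG_gt0 oO ne0 OM hf hfpos wg wE.
have [m [m0 hm]] := cubic_roots ha (mulr_gt0 hb D0).
exists m; split=> // mu; have [h3 h2 h1] := hm mu.
have sol k := @has_exactly_weak_solution _ _ _ oO ne0 _ OM hN _ hf hfpos _ _
  wg wE k a b mu.
split=> hmu; apply: sol.
- by case/andP: hmu => + _; rewrite normr_gt0.
- exact: h3.
- by case: hmu => ->; rewrite ?oppr_eq0 gt_eqF.
- exact: h2.
- by rewrite -normr_gt0 (lt_trans m0).
- exact: h1.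
Qed.
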